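(* Let $\beta>1$ and let $k=k(n)$ be integers with $1\le k\le n$ and $k=o(n^{1/2})$ as $n\to\infty$. Then there exist constants $c_1,c_2>0$, not depending on $n$, such that the mixing time of the restricted randomized systematic scan dynamics for the Ising model on $K_n$ satisfies $$c_1\frac{n\log n}{k}\le t_{\mathrm{mix}}(1/4)\le c_2\frac{n\log n}{k}.$$
   Context: Let $V=\{1,\dots,n\}$, $\Omega=\{-1,+1\}^V$, and let $\beta>0$. The magnetization is $S(\sigma)=\frac1n\sum_{v}\sigma(v)$, and $p_+(x)=\frac{1+\tanh(\beta x)}{2}$. A single-site update (mean-field Ising model on $K_n$, no external field) of $\sigma$ at $v$ replaces $\sigma(v)$ by $+1$ with probability $p_+(S(\sigma)-\sigma(v)/n)$ and by $-1$ otherwise. One step of the randomized systematic scan dynamics with parameter $k$: choose $k$ distinct vertices uniformly at random from $V$ together with a uniformly random ordering $v_1,\dots,v_k$ of them, and perform single-site updates successively at $v_1,\dots,v_k$ (each with respect to the current configuration). The restricted randomized systematic scan dynamics is the Markov chain on $\Omega^+=\{\sigma\in\Omega:S(\sigma)\ge0\}$ which, from $\sigma\in\Omega^+$, generates a candidate $\sigma'$ by one step of the randomized systematic scan dynamics from $\sigma$, and then moves to $\sigma'$ if $S(\sigma')\ge0$ and to $-\sigma'$ (all spins reversed) if $S(\sigma')<0$. Let $P$ be the transition matrix of this restricted chain, $\mu^+$ its stationary distribution, $d(t)=\max_{\sigma\in\Omega^+}\|P^t(\sigma,\cdot)-\mu^+\|_{TV}$ and $t_{\mathrm{mix}}(\epsilon)=\min\{t:d(t)\le\epsilon\}$.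 *)

(* Defs.v *)
From HB Require Import structures.
From mathcomp Require Import all_boot all_order all_algebra.
From mathcomp Require Import all_classical all_reals all_analysis.

Set Implicit Arguments.
Unset Strict Implicit.
Unset Printing Implicit Defensive.

Import Order.TTheory GRing.Theory Num.Theory.
Import numFieldNormedType.Exports.

Local Open Scope ring_scope.

Section FiniteMarkovChain.
Variables (R : realType) (T : finType).
Implicit Types (P Q : T -> T -> R) (mu nu : T -> R).

Definition step_id (s t : T) : R := (s == t)%:R.

(* [step_comp P Q] takes a step of [P], then a step of [Q] *)
Definition step_comp P Q (s t : T) : R := \sum_(u : T) P s u * Q u t.

Definition step_pow P (m : nat) : T -> T -> R := iter m (step_comp P) step_id.

Definition stationary_distribution P mu : Prop :=
  [/\ forall s, 0 <= mu s, \sum_s mu s = 1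
    & forall t, \sum_s mu s * P s t = mu t].

Definition tv_dist mu nu : R := 2^-1 * \sum_s `|mu s - nu s|.

(* the maximum over the starting state; [tv_dist] is nonnegative, so the
   default value 0 is harmless *)
Definition worst_dist P mu (m : nat) : R :=
  \big[Num.max/0]_(s : T) tv_dist (step_pow P m s) mu.

(* least [m] with [worst_dist P mu m <= eps], and +oo if there is none *)
Definition mixing_time P mu (eps : R) : \bar R :=
  ereal_inf [set m%:R%:E | m in [set m : nat | worst_dist P mu m <= eps]%classic].

End FiniteMarkovChain.

(* [true] stands for the spin +1 and [false] for the spin -1 *)
Definition config (n : nat) : finType := {ffun 'I_n -> bool}.

Definition spin (R : realType) (b : bool) : R := if b then 1 else -1.

Definition set_spin n (s : config n) (v : 'I_n) (b : bool) : config n :=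
  [ffun w => if w == v then b else s w].

Definition flip_spins n (s : config n) : config n := [ffun w => ~~ s w].

Definition magnetization (R : realType) n (s : config n) : R :=
  (\sum_(v < n) spin R (s v)) / n%:R.

Definition tanh (R : realType) (x : R) : R :=
  (expR x - expR (- x)) / (expR x + expR (- x)).

Definition p_plus (R : realType) (beta x : R) : R := (1 + tanh (beta * x)) / 2.

Section Dynamics.
Variables (R : realType) (beta : R) (n : nat).

Definition site_update (v : 'I_n) (s t : config n) : R :=
  let p := p_plus beta (magnetization R s - spin R (s v) / n%:R) in
  p * (t == set_spin s v true)%:R + (1 - p) * (t == set_spin s v false)%:R.

(* successive updates at the vertices of [vs], from left to right *)
Definition scan (vs : seq 'I_n) : config n -> config n -> R :=
  foldr (fun v Q => step_comp (site_update v) Q) (@step_id R (config n)) vs.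

(* a uniformly random set of [k] distinct vertices in uniformly random order is
   a uniformly random duplicate-free [k]-tuple *)
Definition rss_step (k : nat) (s t : config n) : R :=
  #|[set vs : k.-tuple 'I_n | uniq vs]|%:R^-1 *
  \sum_(vs : k.-tuple 'I_n | uniq vs) scan vs s t.

Definition omega_plus : finType := {s : config n | 0 <= magnetization R s}.

Definition fold_plus (s : config n) : config n :=
  if 0 <= magnetization R s then s else flip_spins s.

Definition restricted_rss (k : nat) (s t : omega_plus) : R :=
  \sum_(u : config n) rss_step k (val s) u * (fold_plus u == val t)%:R.

End Dynamics.

(* Main.v *)
Require Import Defs.
From HB Require Import structures.
From mathcomp Require Import all_boot all_order all_algebra.
From mathcomp Require Import all_classical all_reals all_analysis.
From mathcomp Require Import zify ring lra.

(** The dynamics is studied through the magnetization [S] of the current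
    configuration.  An update at a random vertex moves [S] by
    [(tanh (beta * S) - S) / n] on average, with noise of order [1 / n].  For
    [beta > 1] the point [S = 0] repels, and folding by the global spin flip
    leaves one attracting point, the positive root of [tanh (beta * S) = S].

    A scan draws its vertices without replacement, but it can be drawn one fresh
    vertex after the other ([fresh_scan_mean]); given the past, the mean increment
    of [n * S] in one update differs from [tanh (beta * S) - S] by [O(k / n)]
    ([fresh_drift_approx]).  Near 0 the noise dominates up to [S] of order
    [n^-1/2], and since [k = o(n^1/2)] the error is negligible against
    [n^-1/2].

    Upper bound.  There are [0 < s0 < s1] such that [tanh (beta * x)] exceeds [x] by
    a factor larger than 1 for [0 < x <= s1] and is a strict contraction for [s0 <= x]
    ([escape_and_contraction_window]).  While two copies of the chain have
    magnetization above [s0], updating the same vertices in both multiplies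
    their expected Hamming distance by [1 - c * k / n] in each scan
    ([fresh_scan_contracts]).  A copy below [s0] is watched by the potential
    [max 0 ((S ^+ 2 + K / n)^-1 - s1 ^- 2) ^+ 4], which decays by the factor
    [1 - c / n] per update up to [O(n ^- 4)]: away from 0 by the repulsion, near 0
    by the noise ([escape_potential_drift]).  The Hamming distance plus a multiple
    of order [n ^+ 2] of the two potentials therefore contracts by
    [1 - c * k / n] per scan for all pairs ([one_step_contraction]).  It is
    at most polynomial in [n] initially, so [O(n * ln n / k)] scans suffice.
    Instead of constructing couplings, the argument bounds the differences of
    expectations of test functions from two starting states.

    Lower bound.  Let [Z] be the sum of the spins with alternating signs.  Its drift
    is [- Z / n] up to small errors, so the stationary mean of [Z ^+ 2] is [O(n)]
    ([stationary_sqr_imbalance]).  Started from [Z = n], the mean of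
    [(Z ^+ 2 + n)^-1] grows by a factor at most [1 + O(1 / n)] per update
    ([inverse_imbalance_drift]), so [Z ^+ 2] remains far above order [n] for
    [c * n * ln n] updates, if [c] is small.  The square of [Z] does not notice the folding.

    These bounds hold for large [n].  For the remaining [n], all-plus is
    reached from everywhere with positive probability, which gives a finite
    mixing time ([mixes_eventually]), and the mixing time is at least 1 unless
    there is just one vertex. *)

Set Implicit Arguments.
Unset Strict Implicit.
Unset Printing Implicit Defensive.
Import Order.TTheory GRing.Theory Num.Theory.
Import numFieldNormedType.Exports.
Local Open Scope ring_scope.

(** * The hyperbolic tangent *)

Section HyperbolicTangent.
Local Open Scope classical_set_scope.
Variable R : realType.
Implicit Types x y u : R.

Lemma tanh_den_gt0 x : 0 < expR x + expR (- x).
Proof. by rewrite addr_gt0 ?expR_gt0. Qed.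

Lemma tanh0 : tanh (0 : R) = 0.
Proof. by rewrite /tanh oppr0 subrr mul0r. Qed.

Lemma tanhN x : tanh (- x) = - tanh x.
Proof. by rewrite /tanh opprK -mulNr opprB [expR (- x) + expR x]addrC. Qed.

Lemma tanh_gtN1 x : -1 < tanh x.
Proof.
rewrite /tanh ltr_pdivlMr ?tanh_den_gt0//.
by have := expR_gt0 x; lra.
Qed.

Lemma tanh_lt1 x : tanh x < 1.
Proof. by rewrite -[x]opprK tanhN ltrNl tanh_gtN1. Qed.

Lemma is_derive_tanh x : is_derive x 1 (@tanh R) (1 - tanh x ^+ 2).
Proof.
have h := lt0r_neq0 (tanh_den_gt0 x).
have -> : @tanh R = (fun y => (expR y - expR (- y)) * (expR y + expR (- y))^-1) by [].
apply: is_derive_eq.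
rewrite /GRing.scale/= /tanh.
move: h; rewrite expRN; have h := lt0r_neq0 (expR_gt0 x) => h2.
field; rewrite h/= .
by apply: contra_neq h2 => h2; apply: (mulIf h); rewrite mul0r -h2; field.
Qed.

Lemma tanh_continuous : continuous (@tanh R).
Proof.
move=> z; apply: differentiable_continuous; apply/derivable1_diffP.
by have [] := is_derive_tanh z.
Qed.

Lemma tanh_MVT x y : x < y ->
  exists2 z, x < z < y & tanh y - tanh x = (1 - tanh z ^+ 2) * (y - x).
Proof.
move=> xy.
have c : {within `[x, y], continuous (@tanh R)}.
  by apply: continuous_subspaceT => z; exact: tanh_continuous.
have [z zxy h] := MVT xy (fun z _ => is_derive_tanh z) c.
by exists z => //; move: zxy; rewrite in_itv.
Qed.

Lemma tanh_sqr_lt1 x : tanh x ^+ 2 < 1.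
Proof. by have := tanh_lt1 x; have := tanh_gtN1 x; nra. Qed.

Lemma ltr_tanh x y : x < y -> tanh x < tanh y.
Proof.
move=> xy; have [z _ h] := tanh_MVT xy.
rewrite -subr_gt0 h mulr_gt0 ?subr_gt0//; exact: tanh_sqr_lt1.
Qed.

Lemma ler_tanh x y : x <= y -> tanh x <= tanh y.
Proof. by rewrite le_eqVlt => /predU1P[->//|/ltr_tanh/ltW]. Qed.

Lemma tanh_ge0 x : 0 <= x -> 0 <= tanh x.
Proof. by rewrite -{2}tanh0; exact: ler_tanh. Qed.

Lemma tanh_lipschitz x y : `|tanh x - tanh y| <= `|x - y|.
Proof.
wlog xy : x y / y < x.
  move=> H; have [/H//|/H|->] := ltgtP y x; last by rewrite !subrr.
  by rewrite distrC [leRHS]distrC.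
have [z _ ->] := tanh_MVT xy.
rewrite normrM ler_piMl// ger0_norm; last by rewrite subr_ge0 ltW// tanh_sqr_lt1.
by have := sqr_ge0 (tanh z); lra.
Qed.

(** Beyond [u] the derivative [1 - tanh ^+ 2] is at most its value at [u]. *)
Lemma tanh_lipschitz_ge u x y : 0 <= u -> u <= x -> u <= y ->
  `|tanh x - tanh y| <= (1 - tanh u ^+ 2) * `|x - y|.
Proof.
move=> u0; wlog xy : x y / y < x.
  move=> H ux uy; have [yx|xy|->] := ltgtP y x; first exact: H.
    by rewrite distrC [`|x - y|]distrC; exact: H.
  by rewrite !subrr normr0 mulr0.
move=> ux uy.
have [z /andP[yz zx] ->] := tanh_MVT xy.
have hz := tanh_sqr_lt1 z.
rewrite normrM ler_wpM2r// ger0_norm; last by rewrite subr_ge0 ltW.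
rewrite lerD2l lerNr opprK.
have uz : tanh u <= tanh z by apply: ler_tanh; lra.
have := tanh_ge0 u0; nra.
Qed.

(** The graph of the hyperbolic tangent lies above its chords from the origin
    by concavity: the slopes given by the mean value theorem on the two sides of
    [x] decrease. *)
Lemma tanh_ge_chord u x : 0 <= x <= u -> tanh u * x <= tanh x * u.
Proof.
case/andP; rewrite le_eqVlt => /predU1P[<- _|x0]; first by rewrite tanh0 mulr0 mul0r.
rewrite le_eqVlt => /predU1P[->//|xu].
have [z1 /andP[z10 z1x]] := tanh_MVT x0; rewrite tanh0 !subr0 => h1.
have [z2 /andP[xz2 z2u]] := tanh_MVT xu => h2.
have zz : tanh z1 <= tanh z2 by apply: ler_tanh; lra.
have z0 : 0 <= tanh z1 by apply: tanh_ge0; lra.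
have hh : 1 - tanh z2 ^+ 2 <= 1 - tanh z1 ^+ 2 by nra.
have -> : tanh u = (tanh u - tanh x) + tanh x by rewrite subrK.
rewrite h2 h1.
move: hh; set p := 1 - _ ^+ 2; set q := 1 - _ ^+ 2 => hh.
have : 0 <= (q - p) * (x * (u - x)) by rewrite mulr_ge0 ?subr_ge0// mulr_ge0// ?subr_ge0 ltW.
by nra.
Qed.

Lemma tanh_gt_tangent u : 0 < u -> u * (1 - tanh u ^+ 2) < tanh u.
Proof.
move=> u0; have [z /andP[z0 zu]] := tanh_MVT u0; rewrite tanh0 !subr0 => h.
rewrite [ltRHS]h mulrC ltr_pM2r// ltrD2l ltrNl opprK.
have := ltr_tanh zu; have := tanh_ge0 (ltW z0); nra.
Qed.

(** The preimage is [(1 / 2) * ln ((1 + y) / (1 - y))]. *)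
Lemma tanh_surj y : 0 < y < 1 -> exists2 u, 0 < u & tanh u = y.
Proof.
move=> /andP[y0 y1]; set q := (1 + y) / (1 - y).
have q1 : 1 < q by rewrite /q ltr_pdivlMr; lra.
have l0 : 0 < ln q by rewrite ln_gt0.
exists (2^-1 * ln q); first by rewrite mulr_gt0// invr_gt0.
have e : expR (2^-1 * ln q) * expR (2^-1 * ln q) = q.
  rewrite -expRD -mulrDl; have -> : (2^-1 : R) + 2^-1 = 1 by lra.
  by rewrite mul1r lnK// posrE; lra.
rewrite /tanh expRN; set a := expR _ in e *.
have a0 : 0 < a := expR_gt0 _.
have e2 : (a * a) * (1 - y) = 1 + y by rewrite e /q mulfVK//; lra.
have a2 : 0 < a * a by rewrite mulr_gt0.
apply: (@mulIf _ (a + a^-1)); first by rewrite lt0r_neq0// addr_gt0// invr_gt0.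
rewrite mulfVK; last by rewrite lt0r_neq0// addr_gt0// invr_gt0.
apply: (mulIf (lt0r_neq0 a0)).
have aa : a^-1 * a = 1 by rewrite mulVf// lt0r_neq0.
by rewrite mulrBl -mulrA mulrDl aa; lra.
Qed.

(** The fixed point equation [tanh (beta * x) = x] has a positive root, at which
    [tanh (beta * x)] has slope below 1.  The slope already equals 1 at a smaller
    point [x], where [tanh (beta * x) ^+ 2 = 1 - beta^-1]; there
    [x < tanh (beta * x)] still holds strictly, because the tangent
    line to the graph of [tanh] at [beta * x] passes above the origin.  So on a small
    window from [s0] to [s1] just to the right of that point both properties
    hold at once: up to [s1] the magnetization is pushed away from 0, and from [s0] on
    the response to a change of the magnetization is a strict contraction. *)
Lemma escape_and_contraction_window (beta : R) : 1 < beta ->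
  exists s0 s1 gamma L : R,
   [/\ 0 < s0, s0 < s1, 0 < gamma, 0 < L & L < 1] /\
   (forall x, 0 <= x <= s1 -> (1 + gamma) * x <= tanh (beta * x)) /\
   (forall x y, s0 <= x -> s0 <= y ->
      `|tanh (beta * x) - tanh (beta * y)| <= L * `|x - y|).
Proof.
move=> b1; have b0 : 0 < beta by lra.
have ib : 0 < beta^-1 < 1 by rewrite invr_gt0 b0 invf_lt1.
(* [u / beta] is the point at which [tanh (beta * x)] has slope 1 *)
set y := Num.sqrt (1 - beta^-1).
have y2 : y ^+ 2 = 1 - beta^-1 by rewrite sqr_sqrtr//; lra.
have y01 : 0 < y < 1.
  have y0 : 0 < y by rewrite sqrtr_gt0; lra.
  rewrite y0/=; nra.
have [u u0 hu] := tanh_surj y01.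
have hu1 : u / beta < tanh u.
  by have := tanh_gt_tangent u0; rewrite hu y2; lra.
have [u1 uu1 hu1'] : exists2 u1, u < u1 & u1 / beta < tanh u1.
  have /cvgrPdist_lt /(_ _ _)/nbhs_ballP := @tanh_continuous u.
  set e := (tanh u - u / beta) / 2.
  have e0 : 0 < e by rewrite /e; lra.
  move=> /(_ e e0)[d /= d0 H].
  set h := Num.min (d / 2) (e / 2).
  have h0 : 0 < h by rewrite lt_min; apply/andP; split; lra.
  have hd : h <= d / 2 by rewrite ge_min lexx.
  have he : h <= e / 2 by rewrite ge_min lexx orbT.
  exists (u + h); first lra.
  have /H : ball u d (u + h).
    by rewrite /ball/= opprD addrA subrr sub0r normrN gtr0_norm//; lra.
  move=> /ltr_normlP [p1 p2].
  have hb : h / beta <= h by rewrite ler_piMr ?ltW//; case/andP: ib.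
  have e2 : e * 2 = tanh u - u / beta by rewrite /e; lra.
  by rewrite mulrDl; clear H; lra.
set u2 := (u + u1) / 2.
have u2b : u < u2 < u1 by rewrite /u2; lra.
exists (u2 / beta), (u1 / beta), (beta * tanh u1 / u1 - 1), (beta * (1 - tanh u2 ^+ 2)).
have u10 : 0 < u1 by lra.
split; [split|split].
- by rewrite divr_gt0//; lra.
- by rewrite ltr_pM2r ?invr_gt0//; lra.
- rewrite subr_gt0 ltr_pdivlMr// mul1r.
  by move: hu1'; rewrite ltr_pdivrMr// mulrC.
- by rewrite mulr_gt0// subr_gt0 tanh_sqr_lt1.
- have : tanh u < tanh u2 by apply: ltr_tanh; lra.
  rewrite hu => h.
  have : y ^+ 2 < tanh u2 ^+ 2 by nra.
  rewrite y2 => h2.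
  rewrite -ltr_pdivlMl// mulr1; lra.
- move=> x /andP[x0]; rewrite ler_pdivlMr// => xu.
  rewrite addrC subrK.
  have bx : 0 <= beta * x <= u1.
    by rewrite [beta * x]mulrC xu andbT mulr_ge0// ltW.
  have := tanh_ge_chord bx.
  have -> : beta * tanh u1 / u1 * x = (tanh u1 * (beta * x)) / u1 by ring.
  by rewrite (ler_pdivrMr _ _ u10).
- move=> x z sx sz.
  have h0 : 0 <= u2 by lra.
  have := @tanh_lipschitz_ge u2 (beta * x) (beta * z) h0.
  rewrite -mulrBr normrM (gtr0_norm b0).
  rewrite -ler_pdivrMl// mulrC sx -ler_pdivrMl// mulrC sz => /(_ isT isT).
  by rewrite mulrA [_ * beta]mulrC.
Qed.
End HyperbolicTangent.

(** * Expectations and random scans *)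

Section Expectation.
Variables (R : realType) (T : finType).
Implicit Types (P : T -> T -> R) (f : T -> R) (s : T).

Definition expect P f s : R := \sum_t P s t * f t.

Lemma expect_step_comp P Q f s :
  expect (step_comp P Q) f s = expect P (expect Q f) s.
Proof.
rewrite /expect /step_comp.
under eq_bigr do rewrite mulr_suml.
rewrite exchange_big/=; apply: eq_bigr => u _.
by rewrite mulr_sumr; apply: eq_bigr => t _; rewrite mulrA.
Qed.

Lemma expect_step_id f s : expect (@step_id R T) f s = f s.
Proof.
rewrite /expect /step_id (bigD1 s)//= eqxx mul1r big1 ?addr0// => t ts.
by rewrite eq_sym (negbTE ts) mul0r.
Qed.

Lemma expect_step_powS P m f s :
  expect (step_pow P m.+1) f s = expect P (expect (step_pow P m) f) s.
Proof. exact: expect_step_comp. Qed.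

End Expectation.

Section RandomScan.
Variables (R : realType) (beta : R) (n : nat).
Implicit Types (f g : config n -> R) (s t : config n) (v : 'I_n) (U : {set 'I_n}).

Definition plus_prob s v : R :=
  p_plus beta (magnetization R s - spin R (s v) / n%:R).

Lemma plus_prob_gt0 s v : 0 < plus_prob s v.
Proof. by rewrite /plus_prob /p_plus divr_gt0//; have := tanh_gtN1 (beta * (magnetization R s - spin R (s v) / n%:R)); lra. Qed.

Lemma plus_prob_lt1 s v : plus_prob s v < 1.
Proof. by rewrite /plus_prob /p_plus ltr_pdivrMr//; have := tanh_lt1 (beta * (magnetization R s - spin R (s v) / n%:R)); lra. Qed.

Definition update_mean v f s : R :=
  plus_prob s v * f (set_spin s v true) +
  (1 - plus_prob s v) * f (set_spin s v false).

Lemma expect_site_update v f s :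
  expect (site_update beta v) f s = update_mean v f s.
Proof.
rewrite /expect /site_update /update_mean /plus_prob; move: (p_plus _ _) => p.
under eq_bigr do rewrite mulrDl -!mulrA.
rewrite big_split/= -!mulr_sumr; congr (_ * _ + _ * _).
  rewrite (bigD1 (set_spin s v true))//= eqxx mul1r big1 ?addr0// => t.
  by move/negbTE ->; rewrite mul0r.
rewrite (bigD1 (set_spin s v false))//= eqxx mul1r big1 ?addr0// => t.
by move/negbTE ->; rewrite mul0r.
Qed.

Definition fresh_update_mean U f s : R :=
  (\sum_(v | v \notin U) update_mean v f s) / #|~: U|%:R.

(** Here [U] is the set of the vertices used up so far.  A uniformly random
    duplicate-free tuple can be drawn one entry at a time, each uniform among the
    vertices that are still fresh; this turns a scan into a recursion on which
    estimates for a single update can be propagated by induction. *)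
Fixpoint fresh_scan_mean (j : nat) U f s : R :=
  if j is j'.+1 then
    (\sum_(v | v \notin U) update_mean v (fresh_scan_mean j' (v |: U) f) s)
      / #|~: U|%:R
  else f s.

Lemma update_mean_le v f g s : (forall b, f (set_spin s v b) <= g (set_spin s v b)) ->
  update_mean v f s <= update_mean v g s.
Proof.
move=> fg; rewrite /update_mean lerD// ler_wpM2l//.
  exact/ltW/plus_prob_gt0.
by rewrite subr_ge0 ltW// plus_prob_lt1.
Qed.

Lemma update_mean_affine v a c f s :
  update_mean v (fun t => a * f t + c) s = a * update_mean v f s + c.
Proof. by rewrite /update_mean; ring. Qed.

Lemma card_fresh U v : v \notin U -> #|~: (v |: U)|.+1 = #|~: U|.
Proof.
move=> vU; rewrite [RHS](cardsD1 v) inE vU/= add1n; congr (_.+1).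
by apply: eq_card => w; rewrite !inE negb_or.
Qed.

Lemma card_fresh_gt0 U k : (#|U| < k)%N -> (k <= n)%N -> (0 < #|~: U|)%N.
Proof.
by have := cardsC U; rewrite card_ord; move: #|U| #|~: U| => a b; clear; lia.
Qed.

Lemma fresh_mean_le U (F G : 'I_n -> R) : (forall v, v \notin U -> F v <= G v) ->
  (\sum_(v | v \notin U) F v) / #|~: U|%:R <= (\sum_(v | v \notin U) G v) / #|~: U|%:R.
Proof.
by move=> FG; rewrite ler_wpM2r ?invr_ge0// ler_sum.
Qed.

Lemma fresh_mean_cst U c : (0 < #|~: U|)%N ->
  (\sum_(v | v \notin U) c) / #|~: U|%:R = c :> R.
Proof.
move=> U0; rewrite sumr_const -[c *+ _]mulr_natr.
rewrite (_ : #|_| = #|~: U|); first by rewrite mulfK// pnatr_eq0 -lt0n.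
by apply: eq_card => w; rewrite !inE.
Qed.

Lemma fresh_mean_affine U a c (F : 'I_n -> R) : (0 < #|~: U|)%N ->
  (\sum_(v | v \notin U) (a * F v + c)) / #|~: U|%:R =
  a * ((\sum_(v | v \notin U) F v) / #|~: U|%:R) + c.
Proof.
move=> U0; rewrite big_split/= mulrDl fresh_mean_cst//; congr (_ + _).
by rewrite -mulr_sumr mulrA.
Qed.

Lemma fresh_scan_mean_le j U f g s : (forall t, f t <= g t) ->
  fresh_scan_mean j U f s <= fresh_scan_mean j U g s.
Proof.
move=> fg; elim: j U s => [//|j IH] U s /=.
by apply: fresh_mean_le => v vU; apply: update_mean_le.
Qed.

Lemma fresh_scan_mean_affine j U a c f s : (j <= #|~: U|)%N ->
  fresh_scan_mean j U (fun t => a * f t + c) s = a * fresh_scan_mean j U f s + c.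
Proof.
elim: j U s => [//|j IH] U s /= jU.
rewrite -fresh_mean_affine; last exact: leq_ltn_trans jU.
congr (_ / _); apply: eq_bigr => v vU; rewrite -update_mean_affine.
by rewrite /update_mean !IH// -ltnS card_fresh.
Qed.

Lemma sum_tuple_cons j (F : j.+1.-tuple 'I_n -> R) :
  \sum_(vs : j.+1.-tuple 'I_n) F vs =
  \sum_v \sum_(vs : j.-tuple 'I_n) F [tuple of v :: vs].
Proof.
rewrite pair_big/=.
rewrite (reindex (fun p : 'I_n * j.-tuple 'I_n => [tuple of p.1 :: p.2]))//=.
exists (fun vs : j.+1.-tuple 'I_n => (thead vs, [tuple of behead vs])).
  by move=> [v vs] _ /=; congr pair; rewrite ?theadE//; apply: val_inj.
by move=> vs _ /=; rewrite -tuple_eta.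
Qed.

(** Splitting off the first entry of the tuple is one step of the recursion of
    [fresh_scan_mean]; the falling factorial counts the admissible tuples. *)
Lemma sum_uniq_scan j U f s : (j <= #|~: U|)%N ->
  \sum_(vs : j.-tuple 'I_n | uniq vs && all [predC U] vs) expect (scan beta vs) f s
  = (#|~: U| ^_ j)%:R * fresh_scan_mean j U f s.
Proof.
elim: j U s => [|j IH] U s jU.
  rewrite (eq_bigl xpredT); last by move=> vs; rewrite tuple0.
  rewrite (eq_bigr (fun _ => f s)); last first.
    by move=> vs _; rewrite tuple0 /= expect_step_id.
  by rewrite sumr_const card_tuple expn0 mulr1n ffactn0 mul1r.
rewrite big_mkcond sum_tuple_cons /=.
have U0 : (#|~: U|%:R : R) != 0 by rewrite pnatr_eq0 -lt0n (leq_ltn_trans _ jU).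
rewrite ffactnS natrM mulrAC [_%:R * _]mulrC mulfVK// mulrC mulr_sumr [RHS]big_mkcond/=.
apply: eq_bigr => v _; case: ifPn => vU; last first.
  by apply: big1 => vs _; rewrite andbF.
rewrite -big_mkcond/=.
have jU' : (j <= #|~: (v |: U)|)%N by rewrite -ltnS card_fresh.
transitivity (\sum_(vs : j.-tuple 'I_n | uniq vs && all [predC v |: U] vs)
    update_mean v (expect (scan beta vs) f) s).
  apply: eq_big => [vs|vs _]; last by rewrite expect_step_comp expect_site_update.
  rewrite /= -andbA andbCA; congr (_ && _).
  rewrite -has_pred1 -all_predC -all_predI; apply: eq_all => w /=.
  by rewrite !inE negb_or.
rewrite -(card_fresh vU)/= -(addr0 (_ * update_mean _ _ _)) -update_mean_affine.
rewrite /update_mean !addr0 -!IH// big_split/= -!mulr_sumr.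
by [].
Qed.

Lemma expect_rss_step k f s : (k <= n)%N ->
  expect (rss_step beta k) f s = fresh_scan_mean k finset.set0 f s.
Proof.
move=> kn.
have k0 : (k <= #|~: (finset.set0 : {set 'I_n})|)%N by rewrite finset.setC0 cardsT card_ord.
have H g t : \sum_(vs : k.-tuple 'I_n | uniq vs) expect (scan beta vs) g t
    = (#|~: (finset.set0 : {set 'I_n})| ^_ k)%:R * fresh_scan_mean k finset.set0 g t.
  rewrite -sum_uniq_scan//; apply: eq_bigl => vs.
  by rewrite (@eq_all _ _ predT) ?all_predT ?andbT// => w; rewrite /= inE.
rewrite /expect /rss_step.
under eq_bigr do rewrite -mulrA mulr_suml.
rewrite -mulr_sumr exchange_big/= -[RHS]mul1r.
have -> : \sum_(vs : k.-tuple 'I_n | uniq vs) \sum_t scan beta vs s t * f t =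
   \sum_(vs : k.-tuple 'I_n | uniq vs) expect (scan beta vs) f s by [].
rewrite H mulrA; congr (_ * _).
have -> : #|[set vs : k.-tuple 'I_n | uniq vs]| = (n ^_ k)%N.
  rewrite -[in RHS](card_ord n) -(card_uniq_tuples k predT).
  by apply: eq_card => vs; rewrite !inE all_predT.
rewrite finset.setC0 cardsT card_ord.
by rewrite mulVf// pnatr_eq0 -lt0n ffact_gt0.
Qed.

End RandomScan.

(** * Total variation and the restricted chain *)

Section StochasticKernel.
Variables (R : realType) (T : finType) (P : T -> T -> R).
Hypothesis P_ge0 : forall s t, 0 <= P s t.
Hypothesis P_sum1 : forall s, \sum_t P s t = 1.
Implicit Types (f g F : T -> R) (mu : T -> R) (s t : T).

Lemma expect_le f g s : (forall t, f t <= g t) -> expect P f s <= expect P g s.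
Proof. by move=> fg; apply: ler_sum => t _; rewrite ler_wpM2l. Qed.

Lemma expect_affine a c f s :
  expect P (fun t => a * f t + c) s = a * expect P f s + c.
Proof.
rewrite /expect mulr_sumr -[c in RHS]mul1r -(P_sum1 s) mulr_suml -big_split/=.
by apply: eq_bigr => t _; ring.
Qed.

Lemma step_pow_ge0 m s t : 0 <= step_pow P m s t.
Proof.
elim: m s => [|m IH] s; first by rewrite /step_pow/= /step_id ler0n.
by rewrite /step_pow iterS; apply: sumr_ge0 => u _; rewrite mulr_ge0//; exact: IH.
Qed.

Lemma step_pow_sum1 m s : \sum_t step_pow P m s t = 1.
Proof.
have E k u : \sum_t step_pow P k u t = expect (step_pow P k) (fun=> 1) u.
  by rewrite /expect; apply: eq_bigr => t _; rewrite mulr1.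
elim: m s => [|m IH] s; first by rewrite E expect_step_id.
rewrite E expect_step_powS -[RHS](P_sum1 s); apply: eq_bigr => u _.
by rewrite -E IH mulr1.
Qed.

Lemma expect_step_pow_le rho F m s : 0 <= rho ->
  (forall t, expect P F t <= rho * F t) ->
  expect (step_pow P m) F s <= rho ^+ m * F s.
Proof.
move=> rho0 H; elim: m s => [|m IH] s; first by rewrite expect_step_id mul1r.
rewrite expect_step_powS; apply: (le_trans (expect_le _ IH)).
have := @expect_affine (rho ^+ m) 0 F s.
rewrite addr0 (_ : expect _ _ _ = expect P (fun t => rho ^+ m * F t) s); last first.
  by apply: eq_bigr => t _; rewrite addr0.
by move=> ->; rewrite exprSr -mulrA ler_wpM2l// exprn_ge0.
Qed.

Lemma stationary_expect mu f : stationary_distribution P mu ->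
  \sum_s mu s * expect P f s = \sum_s mu s * f s.
Proof.
case=> _ _ st; rewrite /expect.
under eq_bigr do rewrite mulr_sumr.
rewrite exchange_big/=; apply: eq_bigr => t _.
by rewrite -[in RHS]st mulr_suml; apply: eq_bigr => s _; rewrite mulrA.
Qed.

Lemma stationary_step_pow mu m : stationary_distribution P mu ->
  stationary_distribution (step_pow P m) mu.
Proof.
move=> st; case: (st) => mu0 mu1 st1; split => // t.
have E k u : step_pow P k u t = expect (step_pow P k) (fun w => (w == t)%:R) u.
  rewrite /expect (bigD1 t)//= eqxx mulr1 big1 ?addr0// => w /negbTE->.
  by rewrite mulr0.
elim: m => [|m IH].
  under eq_bigr do rewrite E expect_step_id.
  rewrite (bigD1 t)//= eqxx mulr1 big1 ?addr0// => w /negbTE->.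
  by rewrite mulr0.
under eq_bigr do rewrite E expect_step_powS.
rewrite stationary_expect// -[RHS]IH.
by apply: eq_bigr => u _; rewrite -E.
Qed.

(** Averaging the second starting state over the stationary law turns the
    comparison with [mu] into a comparison of two starting states.  The total
    variation distance is attained by the test function equal to [1 / 2] where
    the law at time [m] dominates and to [- 1 / 2] elsewhere, whose oscillation
    is at most 1.  Quantifying over such functions replaces the construction of
    couplings. *)
Lemma worst_dist_le mu m (B : R) : 0 <= B -> stationary_distribution P mu ->
  (forall f s t, (forall u w, f u - f w <= (u != w)%:R) ->
    expect (step_pow P m) f s - expect (step_pow P m) f t <= B) ->
  worst_dist P mu m <= B.
Proof.
move=> B0 st H; rewrite /worst_dist.
apply: (big_ind (fun x => x <= B)) => //; first by move=> x y xB yB; rewrite ge_max xB yB.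
move=> s _; case: (stationary_step_pow m st) => mu0 mu1 stm.
pose f t : R := (0 <= step_pow P m s t - mu t)%R%:R - 2^-1.
have -> : tv_dist (step_pow P m s) mu =
    expect (step_pow P m) f s - \sum_t mu t * expect (step_pow P m) f t.
  have -> : \sum_t mu t * expect (step_pow P m) f t = \sum_t mu t * f t.
    rewrite /expect; under eq_bigr do rewrite mulr_sumr.
    rewrite exchange_big/=; apply: eq_bigr => t _.
    by rewrite -[in RHS]stm mulr_suml; apply: eq_bigr => u _; rewrite mulrA.
  rewrite /tv_dist mulr_sumr -sumrB; apply: eq_bigr => t _.
  by rewrite /f; case: ger0P => /= h; lra.
rewrite -[expect _ f s]mul1r -mu1 mulr_suml -sumrB -[B]mul1r -mu1 mulr_suml.
apply: ler_sum => t _; rewrite -mulrBr ler_wpM2l//.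
apply: H => u w; rewrite /f; case: eqVneq => [->|_]; first by rewrite subrr.
by do 2 case: (0 <= _)%R => /=; lra.
Qed.

Lemma worst_dist_ge mu m s g : stationary_distribution P mu ->
  (forall t, 0 <= g t <= 1) ->
  \sum_t mu t * g t - expect (step_pow P m) g s <= worst_dist P mu m.
Proof.
move=> st g01.
apply: (@le_trans _ _ (tv_dist (step_pow P m s) mu)); last first.
  by rewrite /worst_dist (bigD1 s)//= le_max lexx.
have [mu0 mu1 _] := st.
have -> : \sum_t mu t * g t - expect (step_pow P m) g s =
   \sum_t (mu t - step_pow P m s t) * (g t - 2^-1).
  under [RHS]eq_bigr do rewrite mulrBr mulrBl.
  rewrite big_split/= sumrB sumrN.
  rewrite -mulr_suml sumrB mu1 step_pow_sum1 subrr mul0r.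
  by rewrite subr0.
rewrite /tv_dist mulr_sumr; apply: ler_sum => t _.
rewrite distrC; have := ler_norm (mu t - step_pow P m s t).
have := ler_norm (- (mu t - step_pow P m s t)); rewrite normrN.
by have := g01 t; nra.
Qed.

End StochasticKernel.

Section RestrictedChain.
Variables (R : realType) (beta : R) (n k : nat).
Hypothesis kn : (k <= n)%N.
Implicit Types (f g F : config n -> R) (s t : config n) (U : {set 'I_n}).
Local Notation scan_mean f s := (fresh_scan_mean beta k finset.set0 f s).

Lemma magnetization_flip s : magnetization R (flip_spins s) = - magnetization R s.
Proof.
rewrite /magnetization -mulNr -sumrN; congr (_ / _); apply: eq_bigr => v _.
by rewrite ffunE /spin; case: (s v); rewrite ?opprK.
Qed.

Lemma magnetization_fold_plus s : 0 <= magnetization R (fold_plus R s).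
Proof.
rewrite /fold_plus; case: ifPn => // ; rewrite -ltNge => h.
by rewrite magnetization_flip oppr_ge0 ltW.
Qed.

Lemma card_setC_set0 : #|~: (finset.set0 : {set 'I_n})| = n.
Proof. by rewrite finset.setC0 cardsT card_ord. Qed.

(** Folding acts after the scan, hence on the test function. *)
Lemma expect_restricted g (s : omega_plus R n) :
  expect (@restricted_rss R beta n k) (g \o val) s =
  scan_mean (g \o @fold_plus R n) (val s).
Proof.
rewrite -expect_rss_step// /expect /restricted_rss.
under eq_bigr do rewrite mulr_suml.
rewrite exchange_big/=; apply: eq_bigr => u _.
pose w : omega_plus R n := Sub (fold_plus R u) (magnetization_fold_plus u).
rewrite (bigD1 w)//= eqxx mulr1 big1 ?addr0// => t tw.
rewrite (_ : (_ == _) = false) ?mulr0 ?mul0r//.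
by apply: contra_neqF tw => /eqP h; apply: val_inj.
Qed.

Definition fold_omega s : omega_plus R n :=
  Sub (fold_plus R s) (magnetization_fold_plus s).

Lemma fold_omega_val (x : omega_plus R n) : fold_omega (val x) = x.
Proof. by apply: val_inj; rewrite /= /fold_plus (valP x). Qed.

Lemma expect_restricted_fold (f : omega_plus R n -> R) x :
  expect (@restricted_rss R beta n k) f x = scan_mean (f \o fold_omega) (val x).
Proof.
have -> : f = (f \o fold_omega) \o val.
  by apply/funext => y /=; rewrite fold_omega_val.
by rewrite expect_restricted.
Qed.

Lemma scan_mean_cst c s : fresh_scan_mean beta k finset.set0 (fun=> c) s = c.
Proof.
have := @fresh_scan_mean_affine R beta n k finset.set0 0 c (fun=> 0) s.
rewrite card_setC_set0 => /(_ kn) E.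
transitivity (0 * fresh_scan_mean beta k finset.set0 (fun=> 0) s + c).
  rewrite -E; congr (fresh_scan_mean _ _ _ _ _).
  by apply/funext => t; rewrite mul0r add0r.
by rewrite mul0r add0r.
Qed.

Lemma restricted_ge0 (s t : omega_plus R n) : 0 <= @restricted_rss R beta n k s t.
Proof.
have -> : @restricted_rss R beta n k s t =
    expect (@restricted_rss R beta n k) ((fun u => (u == val t)%:R) \o val) s.
  rewrite /expect (bigD1 t)//= eqxx mulr1 big1 ?addr0// => u ut.
  by rewrite (_ : (_ == _) = false) ?mulr0//; apply: contra_neqF ut => /eqP /val_inj.
rewrite expect_restricted -[leLHS](scan_mean_cst 0 (val s)).
by apply: fresh_scan_mean_le => u /=.
Qed.

Lemma restricted_sum1 (s : omega_plus R n) : \sum_t @restricted_rss R beta n k s t = 1.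
Proof.
rewrite -[RHS](scan_mean_cst 1 (val s)).
rewrite -[RHS](@expect_restricted (fun=> 1)).
by apply: eq_bigr => t _; rewrite mulr1.
Qed.

(** A bound on the effect of one update, uniform in the set of the used
    vertices, iterates along the scan although the updates are not independent. *)
Lemma fresh_scan_drift rho tau F U j s : 0 <= rho -> (j + #|U| <= k)%N ->
  (forall U s, (#|U| < k)%N -> fresh_update_mean beta U F s <= rho * F s + tau) ->
  fresh_scan_mean beta j U F s <= rho ^+ j * F s + tau * \sum_(i < j) rho ^+ i.
Proof.
move=> rho0 + H; elim: j U s => [|j IH] U s jU /=.
  by rewrite big_ord0 mulr0 addr0 mul1r.
have UC : (0 < #|~: U|)%N.
  by apply: card_fresh_gt0 kn; apply: leq_trans jU; rewrite addSn ltnS leq_addl.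
pose c := tau * \sum_(i < j) rho ^+ i.
apply: (@le_trans _ _ (rho ^+ j * fresh_update_mean beta U F s + c)).
  rewrite /fresh_update_mean -fresh_mean_affine//.
  apply: fresh_mean_le => v vU; rewrite -update_mean_affine.
  apply: update_mean_le => b; apply: IH.
  by rewrite cardsU1 vU; lia.
apply: (@le_trans _ _ (rho ^+ j * (rho * F s + tau) + c)).
  by rewrite lerD2r ler_wpM2l ?exprn_ge0//; apply: H; lia.
by rewrite /c big_ord_recr/= exprSr; lra.
Qed.

Lemma scan_drift rho tau F s : 0 <= rho ->
  (forall U s, (#|U| < k)%N -> fresh_update_mean beta U F s <= rho * F s + tau) ->
  scan_mean F s <= rho ^+ k * F s + tau * \sum_(i < k) rho ^+ i.
Proof. by move=> rho0; apply: fresh_scan_drift => //; rewrite cards0 addn0. Qed.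

End RestrictedChain.

(** * Signed sums of spins *)

Section SignedSum.
Variables (R : realType) (beta : R) (n : nat).
Implicit Types (s : config n) (x : config n) (v : 'I_n) (U : {set 'I_n}).

Definition signed_sum x s : R := \sum_v spin R (x v) * spin R (s v).

Lemma spin_sqr b : spin R b * spin R b = 1.
Proof. by case: b; rewrite /spin; ring. Qed.

Lemma normr_spin b : `|spin R b| = 1.
Proof. by case: b; rewrite /spin ?normrN normr1. Qed.

Lemma signed_sum_set_spin x s v b :
  signed_sum x (set_spin s v b) =
  signed_sum x s + spin R (x v) * (spin R b - spin R (s v)).
Proof.
rewrite /signed_sum (bigD1 v)//= [in RHS](bigD1 v)//= ffunE eqxx.
rewrite (eq_bigr (fun w => spin R (x w) * spin R (s w))); first by ring.
by move=> w /negbTE wv; rewrite ffunE wv.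
Qed.

Lemma normr_signed_sum x s : `|signed_sum x s| <= n%:R.
Proof.
apply: le_trans (ler_norm_sum _ _ _) _.
rewrite (eq_bigr (fun=> 1)); first by rewrite sumr_const card_ord.
by move=> v _; rewrite normrM !normr_spin mulr1.
Qed.

Definition all_plus : config n := [ffun=> true].

Lemma signed_sum_all_plus s : signed_sum all_plus s = \sum_v spin R (s v).
Proof. by apply: eq_bigr => v _; rewrite ffunE mul1r. Qed.

Lemma magnetizationE s : magnetization R s = signed_sum all_plus s / n%:R.
Proof. by rewrite signed_sum_all_plus. Qed.

Lemma normr_magnetization s : `|magnetization R s| <= 1.
Proof.
rewrite magnetizationE normrM normfV normr_nat.
have [->|n0] := posnP n; first by rewrite invr0 mulr0.
by rewrite ler_pdivrMr ?ltr0n// mul1r normr_signed_sum.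
Qed.

Lemma signed_sum_flip x s : signed_sum x (flip_spins s) = - signed_sum x s.
Proof.
rewrite /signed_sum -sumrN; apply: eq_bigr => v _.
by rewrite ffunE; case: (s v); case: (x v); rewrite /spin/=; ring.
Qed.

Definition local_tanh s v := tanh (beta * (magnetization R s - spin R (s v) / n%:R)).

Lemma plus_probE s v : plus_prob beta s v = (1 + local_tanh s v) / 2.
Proof. by []. Qed.

(** [fresh_drift] and [fresh_square] are the mean increment and the mean squared
    increment of [signed_sum x] in an update at a random fresh vertex: the new
    spin has mean [local_tanh s v], and the increment is 0 or 2 in absolute
    value. *)
Definition fresh_drift U x s : R :=
  (\sum_(v | v \notin U) spin R (x v) * (local_tanh s v - spin R (s v)))
    / #|~: U|%:R.

Definition fresh_square U s : R :=
  (\sum_(v | v \notin U) 2 * (1 - local_tanh s v * spin R (s v))) / #|~: U|%:R.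

(** A function of a signed sum enters the drift estimates only through a
    quadratic majorant in the increment [D]. *)
Lemma fresh_mean_quadratic U x s (F : config n -> R) (c a b : R) : (0 < #|~: U|)%N ->
  (forall v e, let D := spin R (x v) * (spin R e - spin R (s v)) in
    F (set_spin s v e) <= c + a * D + b * D ^+ 2) ->
  fresh_update_mean beta U F s <= c + a * fresh_drift U x s + b * fresh_square U s.
Proof.
move=> U0 H; rewrite /fresh_drift /fresh_square.
have -> : c = (\sum_(v | v \notin U) c) / #|~: U|%:R by rewrite fresh_mean_cst.
rewrite !mulrA -!mulrDl !mulr_sumr -!big_split/=.
apply: fresh_mean_le => v _.
have := H v true; have := H v false.
have := plus_prob_gt0 beta s v; have := plus_prob_lt1 beta s v.
rewrite /update_mean plus_probE; set t := local_tanh s v => t1 t0.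
move: (F _) (F _) => f1 f0.
rewrite /= => h0 h1.
have g0 : (1 - (1 + t) / 2) * f0 <= (1 - (1 + t) / 2) * 
   (c + a * (spin R (x v) * (-1 - spin R (s v))) + b * (spin R (x v) * (-1 - spin R (s v))) ^+ 2).
  by rewrite ler_wpM2l//; lra.
have g1 : (1 + t) / 2 * f1 <= (1 + t) / 2 * 
   (c + a * (spin R (x v) * (1 - spin R (s v))) + b * (spin R (x v) * (1 - spin R (s v))) ^+ 2).
  by rewrite ler_wpM2l//; lra.
apply: le_trans (lerD g1 g0) _.
rewrite le_eqVlt; apply/orP; left; apply/eqP.
by case: (x v); case: (s v); rewrite /spin; field.
Qed.

Lemma normr_local_arg s v : (0 < n)%N ->
  `|magnetization R s - spin R (s v) / n%:R| <= 2.
Proof.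
move=> n0; apply: le_trans (ler_normB _ _) _.
have := normr_magnetization s.
rewrite [`|spin R _ / _|]normrM normr_spin normfV normr_nat.
have : (n%:R : R)^-1 <= 1 by rewrite invf_le1 ?ltr0n// ler1n.
by lra.
Qed.

Definition flip_floor : R := 2 * (1 - tanh (2 * beta)).

Lemma flip_floor_gt0 : 0 < flip_floor.
Proof. by rewrite /flip_floor; have := tanh_lt1 (2 * beta); lra. Qed.

(** The new spin takes either value with probability bounded below, because
    local fields are bounded by 2; hence the noise never degenerates. *)
Lemma fresh_square_bounds U s : 0 < beta -> (0 < #|~: U|)%N ->
  flip_floor <= fresh_square U s <= 4.
Proof.
move=> b0 U0; have n0 : (0 < n)%N.
  by case/card_gt0P: U0 => v _; exact: leq_ltn_trans (ltn_ord v).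
have T v : `|local_tanh s v| <= tanh (2 * beta).
  have h := normr_local_arg s v n0.
  rewrite /local_tanh; move: h; move: (_ - _ / _) => y /ler_normlP[y1 y2].
  have h1 : 0 <= beta * (2 - y) by rewrite mulr_ge0 ?(ltW b0)//; lra.
  have h2 : 0 <= beta * (2 + y) by rewrite mulr_ge0 ?(ltW b0)//; lra.
  by apply/ler_normlP; rewrite -tanhN; split; apply: ler_tanh; lra.
have L v : flip_floor <= 2 * (1 - local_tanh s v * spin R (s v)) <= 4.
  have := T v => /ler_normlP[t1 t2]; have := tanh_lt1 (2 * beta).
  by rewrite /flip_floor /spin; case: (s v) => h; apply/andP; split; lra.
apply/andP; split.
  rewrite -(@fresh_mean_cst _ _ U flip_floor)//.
  by apply: fresh_mean_le => v _; case/andP: (L v).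
rewrite -(@fresh_mean_cst _ _ U 4)//.
by apply: fresh_mean_le => v _; case/andP: (L v).
Qed.

Definition fresh_sign U x : R := (\sum_(v | v \notin U) spin R (x v)) / #|~: U|%:R.

Lemma sum_fresh U (f : 'I_n -> R) :
  \sum_(v | v \notin U) f v = \sum_v f v - \sum_(v in U) f v.
Proof. by rewrite [\sum_v f v](bigID (mem U))/= addrAC subrr add0r. Qed.

Lemma normr_sum_le_card U (f : 'I_n -> R) : (forall v, `|f v| <= 1) ->
  `|\sum_(v in U) f v| <= #|U|%:R.
Proof.
move=> f1; apply: le_trans (ler_norm_sum _ _ _) _.
by rewrite -sum1_card natr_sum ler_sum.
Qed.

(** Removing at most [k] used vertices from an average over all [n >= 2 * k]
    vertices changes it by [O(k / n)], and the self-interaction term changes the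
    local field by [O(1 / n)].  The bound is where the scan without replacement
    differs from single-site dynamics; it is harmless as long as it is small
    against the typical size [n^-1/2] of fluctuations. *)
Lemma fresh_drift_approx U x s k : 0 < beta -> (#|U| < k)%N -> (2 * k <= n)%N ->
  `|fresh_drift U x s -
    (tanh (beta * magnetization R s) * fresh_sign U x - signed_sum x s / n%:R)|
  <= (beta + 4) * (k%:R / n%:R).
Proof.
move=> b0 Uk kn.
have n0 : (0 < n)%N by lia.
have cU := cardsC U; rewrite card_ord in cU.
have U0 : (0 < #|~: U|)%N by lia.
have n0R : 0 < (n%:R : R) by rewrite ltr0n.
have m0R : 0 < (#|~: U|%:R : R) by rewrite ltr0n.
have cUR : (#|U|%:R : R) + #|~: U|%:R = n%:R by rewrite -natrD cU.
have Uk1 : (#|U|%:R : R) + 1 <= k%:R by rewrite natr1 ler_nat.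
have k2 : 2 * (k%:R : R) <= n%:R by rewrite -natrM ler_nat.
have U0R : 0 <= (#|U|%:R : R) by rewrite ler0n.
set T := tanh (beta * magnetization R s).
set S := \sum_(v | v \notin U) spin R (x v) * spin R (s v).
have E : fresh_drift U x s - (T * fresh_sign U x - signed_sum x s / n%:R) =
  (\sum_(v | v \notin U) spin R (x v) * (local_tanh s v - T)) / #|~: U|%:R
  + (signed_sum x s / n%:R - S / #|~: U|%:R).
  rewrite /fresh_drift /fresh_sign /S mulrA mulr_sumr.
  rewrite opprB addrCA [RHS]addrCA -!mulrBl; congr (_ + _ / _).
  by rewrite -!sumrB; apply: eq_bigr => v _; ring.
rewrite E; apply: le_trans (ler_normD _ _) _.
have -> : (beta + 4) * (k%:R / n%:R) = beta * (k%:R / n%:R) + 4 * (k%:R / n%:R).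
  by ring.
apply: lerD.
  apply: (@le_trans _ _ (beta / n%:R)); last first.
    rewrite (ler_wpM2l (ltW b0))// -[leLHS]mul1r ler_wpM2r ?invr_ge0 ?ler0n//; lra.
  rewrite normrM normfV normr_nat.
  rewrite -(@fresh_mean_cst _ _ U (beta / n%:R))// ler_wpM2r ?invr_ge0 ?ler0n//.
  apply: le_trans (ler_norm_sum _ _ _) _; apply: ler_sum => v _.
  rewrite normrM normr_spin mul1r; apply: le_trans (tanh_lipschitz _ _) _.
  rewrite -mulrBr addrAC subrr sub0r normrM normrN normrM normr_spin mul1r.
  by rewrite normfV normr_nat gtr0_norm.
have ZS : `|signed_sum x s - S| <= #|U|%:R.
  rewrite /S sum_fresh opprB addrCA subrr addr0.
  by apply: normr_sum_le_card => v; rewrite normrM !normr_spin mulr1.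
have Zn := normr_signed_sum x s.
move: ZS Zn; set z := signed_sum x s => ZS Zn.
have -> : z / n%:R - S / #|~: U|%:R =
   ((z - S) * n%:R - z * #|U|%:R) / (n%:R * #|~: U|%:R).
  have -> : #|U|%:R = n%:R - #|~: U|%:R :> R by lra.
  by field; rewrite !lt0r_neq0.
rewrite normrM normfV [`|n%:R * _|]gtr0_norm ?mulr_gt0//.
rewrite ler_pdivrMr ?mulr_gt0//.
apply: le_trans (ler_normB _ _) _; rewrite !normrM !normr_nat.
have -> : 4 * (k%:R / n%:R) * (n%:R * #|~: U|%:R) = 4 * k%:R * #|~: U|%:R :> R.
  by field; rewrite lt0r_neq0.
nra.
Qed.

Lemma fresh_sign_all_plus U : (0 < #|~: U|)%N -> fresh_sign U all_plus = 1.
Proof.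
move=> U0; rewrite -[RHS](@fresh_mean_cst _ _ U 1)//; congr (_ / _).
by apply: eq_bigr => v _; rewrite ffunE.
Qed.

End SignedSum.

(** * Lower bound for large systems *)

Section LowerBound.
Variables (R : realType) (beta : R) (n k : nat).
Hypotheses (beta_gt0 : 0 < beta) (k_gt0 : (0 < k)%N) (k2n : (2 * k <= n)%N)
  (kkn : (k * k <= n)%N).
Implicit Types (s : config n) (U : {set 'I_n}).

Definition alternating (p : nat) : config p := [ffun v : 'I_p => ~~ odd v].

Lemma sum_alternating p :
  \sum_v spin R (alternating p v) = (odd p)%:R.
Proof.
transitivity (\sum_(v < p) spin R (~~ odd v)).
  by apply: eq_bigr => v _; rewrite ffunE.
elim: p => [|p IH]; first by rewrite big_ord0.
by rewrite big_ord_recr/= IH; case: (odd p); rewrite /spin/=; ring.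
Qed.

Definition imbalance s : R := signed_sum R (alternating n) s.

Let Ce : R := beta + 6.
Let nR : 0 < (n%:R : R). Proof. by rewrite ltr0n; lia. Qed.
Let kn : (k <= n)%N. Proof. lia. Qed.

(** The alternating signs are balanced up to one vertex, so the common local
    field cancels and only the loss of the old spin, [- imbalance s / n],
    remains. *)
Lemma imbalance_drift U s : (#|U| < k)%N ->
  `|fresh_drift beta U (alternating n) s + imbalance s / n%:R|
     <= Ce * (k%:R / n%:R).
Proof.
move=> Uk; have U0 := card_fresh_gt0 Uk kn.
have cU := cardsC U; rewrite card_ord in cU.
have := fresh_drift_approx (alternating n) s beta_gt0 Uk k2n.
rewrite -/(imbalance s).
set d := fresh_drift _ _ _ _; set z := imbalance s / _.
set T := tanh _; set e := fresh_sign _ _ _ => H.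
have e2 : `|e| <= 2 * (k%:R / n%:R).
  rewrite /e /fresh_sign sum_fresh sum_alternating normrM normfV normr_nat.
  have mR : 0 < (#|~: U|%:R : R) by rewrite ltr0n.
  have -> : 2 * (k%:R / n%:R) = 2 * k%:R / n%:R :> R by ring.
  rewrite ler_pdivrMr// mulrAC ler_pdivlMr//.
  have h : `|(odd n)%:R - \sum_(v in U) spin R (alternating n v)| <= k%:R.
    apply: le_trans (ler_normB _ _) _.
    have : `|\sum_(v in U) spin R (alternating n v)| <= #|U|%:R.
      by apply: normr_sum_le_card => v; rewrite normr_spin.
    have : (#|U|%:R : R) + 1 <= k%:R by rewrite natr1 ler_nat.
    have : `|(odd n)%:R : R| <= 1 by case: (odd n); rewrite ?normr1 ?normr0.
    lra.
  have nm : (n%:R : R) <= 2 * #|~: U|%:R by rewrite -natrM ler_nat; lia.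
  apply: (@le_trans _ _ (k%:R * n%:R)); first by rewrite ler_wpM2r// ltW.
  have : 0 <= (k%:R : R) by [].
  nra.
have T1 : `|T| <= 1.
  by apply/ler_normlP; have := tanh_lt1 (beta * magnetization R s);
     have := tanh_gtN1 (beta * magnetization R s); rewrite -/T; split; lra.
have Te : `|T * e| <= 2 * (k%:R / n%:R).
  by rewrite normrM; apply: le_trans e2; rewrite ler_piMl.
have -> : d + z = (d - (T * e - z)) + T * e by ring.
apply: le_trans (ler_normD _ _) _; rewrite /Ce; lra.
Qed.

Let error_sqr : n%:R * (Ce * (k%:R / n%:R)) ^+ 2 <= Ce ^+ 2.
Proof.
have -> : n%:R * (Ce * (k%:R / n%:R)) ^+ 2 = Ce ^+ 2 * (k%:R ^+ 2 / n%:R).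
  by field; rewrite lt0r_neq0.
rewrite ler_piMr ?sqr_ge0// ler_pdivrMr// mul1r.
by rewrite -natrX ler_nat -mulnn.
Qed.

Let drift_term U s : (#|U| < k)%N ->
  `|imbalance s * fresh_drift beta U (alternating n) s + imbalance s ^+ 2 / n%:R| <=
   (imbalance s ^+ 2 / n%:R + Ce ^+ 2) / 2.
Proof.
move=> Uk; have := imbalance_drift s Uk.
move: (fresh_drift _ _ _ _) (imbalance s) => d z h.
have -> : z * d + z ^+ 2 / n%:R = z * (d + z / n%:R) by ring.
rewrite normrM.
apply: (@le_trans _ _ (`|z| * (Ce * (k%:R / n%:R)))); first by rewrite ler_wpM2l.
have := error_sqr; set E := Ce * _ => hE.
have z2 : z ^+ 2 = `|z| ^+ 2 by rewrite -normrX ger0_norm ?sqr_ge0.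
rewrite z2; move: (`|z|) => y.
have : 0 <= (y / n%:R - E) ^+ 2 * n%:R by rewrite mulr_ge0 ?sqr_ge0 ?ltW.
have -> : (y / n%:R - E) ^+ 2 * n%:R = y ^+ 2 / n%:R - 2 * (y * E) + n%:R * E ^+ 2.
  by field; rewrite lt0r_neq0.
by lra.
Qed.

(** A small value of the imbalance makes this large, so a bound on its mean
    keeps the imbalance away from 0 by Markov's inequality.  The summand [n] is
    the order of its square at equilibrium. *)
Definition inverse_imbalance s : R := (imbalance s ^+ 2 + n%:R)^-1.

(** With [Q] and [Q'] the old and the new value of [z ^+ 2 + a], the difference
    of the two sides is [D ^+ 2 * (8 * Q' - (2 * z + D) ^+ 2) / (Q ^+ 2 * Q')]. *)
Lemma inv_sqr_step (a z D : R) : 1 <= a -> D ^+ 2 <= 4 ->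
  ((z + D) ^+ 2 + a)^-1 <= (z ^+ 2 + a)^-1
     + (- 2 * z / (z ^+ 2 + a) ^+ 2) * D + (7 / (z ^+ 2 + a) ^+ 2) * D ^+ 2.
Proof.
move=> a1 D4; set Q := z ^+ 2 + a; set Q' := (z + D) ^+ 2 + a.
have Q0 : 0 < Q by rewrite /Q; have := sqr_ge0 z; lra.
have Q'0 : 0 < Q' by rewrite /Q'; have := sqr_ge0 (z + D); lra.
rewrite -subr_ge0.
have -> : Q^-1 + - 2 * z / Q ^+ 2 * D + 7 / Q ^+ 2 * D ^+ 2 - Q'^-1 =
   (Q * Q' + (- 2 * z * D + 7 * D ^+ 2) * Q' - Q ^+ 2) / (Q ^+ 2 * Q').
  by field; rewrite !lt0r_neq0.
apply: divr_ge0; last by rewrite mulr_ge0 ?sqr_ge0// ltW.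
have -> : Q * Q' + (- 2 * z * D + 7 * D ^+ 2) * Q' - Q ^+ 2 =
   D ^+ 2 * ((2 * (z + D) + D) ^+ 2 - 2 * D ^+ 2 + 8 * a).
  by rewrite /Q /Q'; ring.
by rewrite mulr_ge0 ?sqr_ge0//; have := sqr_ge0 (2 * (z + D) + D); lra.
Qed.

Lemma spin_increment_sqr (x s : config n) v e :
  (spin R (x v) * (spin R e - spin R (s v))) ^+ 2 <= 4.
Proof. by rewrite /spin; case: (x v); case: e; case: (s v); lra. Qed.

(** Both the drift [- imbalance s / n] and the bounded noise change the square of
    the imbalance, relative to [imbalance s ^+ 2 + n], by [O(1 / n)]. *)
Lemma inverse_imbalance_drift U s : (#|U| < k)%N ->
  fresh_update_mean beta U inverse_imbalance s <=
    (1 + (31 + Ce ^+ 2) / n%:R) * inverse_imbalance s + 0.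
Proof.
move=> Uk; have U0 := card_fresh_gt0 Uk kn.
set z := imbalance s; set Q := z ^+ 2 + n%:R.
have Q0 : 0 < Q by rewrite /Q ltr_wpDl ?sqr_ge0.
have n1 : 1 <= (n%:R : R) by rewrite ler1n; lia.
apply: le_trans (@fresh_mean_quadratic R beta n U (alternating n) s inverse_imbalance
   Q^-1 (- 2 * z / Q ^+ 2) (7 / Q ^+ 2) U0 _) _.
  move=> v e /=; rewrite /inverse_imbalance /imbalance signed_sum_set_spin.
  by apply: inv_sqr_step => //; exact: spin_increment_sqr.
have /ler_normlP[h1 h2] := drift_term s Uk.
have /andP[_ q4] := fresh_square_bounds s beta_gt0 U0.
move: h1 h2 q4; rewrite -/z.
set d := fresh_drift _ _ _ _; set q := fresh_square _ _ _ => h1 h2 q4.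
have -> : Q^-1 + - 2 * z / Q ^+ 2 * d + 7 / Q ^+ 2 * q =
   Q^-1 + (- 2 * (z * d) + 7 * q) / Q ^+ 2 by ring.
rewrite /inverse_imbalance -/z -/Q.
have -> : (1 + (31 + Ce ^+ 2) / n%:R) * Q^-1 + 0 =
   Q^-1 + (31 + Ce ^+ 2) / n%:R * Q^-1 by ring.
rewrite lerD2l.
have -> : (31 + Ce ^+ 2) / n%:R * Q^-1 = ((31 + Ce ^+ 2) / n%:R * Q) / Q ^+ 2.
  by field; rewrite !lt0r_neq0.
rewrite ler_wpM2r ?invr_ge0 ?sqr_ge0//.
have -> : (31 + Ce ^+ 2) / n%:R * Q = (31 + Ce ^+ 2) * (z ^+ 2 / n%:R) + (31 + Ce ^+ 2).
  by rewrite /Q; field; rewrite lt0r_neq0.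
have : 0 <= z ^+ 2 / n%:R by rewrite mulr_ge0 ?sqr_ge0// invr_ge0 ltW.
move: (z ^+ 2 / n%:R) h1 h2 => w h1 h2 w0.
have := sqr_ge0 Ce; move: (Ce ^+ 2) h1 h2 => c h1 h2 c0; nra.
Qed.

Lemma sqr_imbalance_drift U s : (#|U| < k)%N ->
  fresh_update_mean beta U (fun t => imbalance t ^+ 2) s <=
    (1 - n%:R^-1) * imbalance s ^+ 2 + (4 + Ce ^+ 2).
Proof.
move=> Uk; have U0 := card_fresh_gt0 Uk kn.
set z := imbalance s.
apply: le_trans (@fresh_mean_quadratic R beta n U (alternating n) s _
   (z ^+ 2) (2 * z) 1 U0 _) _.
  move=> v e /=; rewrite /imbalance signed_sum_set_spin -/(imbalance s) -/z.
  by rewrite le_eqVlt; apply/orP; left; apply/eqP; ring.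
have /ler_normlP[h1 h2] := drift_term s Uk.
have /andP[_ q4] := fresh_square_bounds s beta_gt0 U0.
move: h1 h2 q4; rewrite -/z.
set d := fresh_drift _ _ _ _; set q := fresh_square _ _ _ => h1 h2 q4.
rewrite mulrBl mul1r [n%:R^-1 * _]mulrC.
have : 0 <= z ^+ 2 / n%:R by rewrite mulr_ge0 ?sqr_ge0// invr_ge0 ltW.
have := sqr_ge0 Ce; lra.
Qed.

Lemma imbalance_fold s : imbalance (fold_plus R s) ^+ 2 = imbalance s ^+ 2.
Proof.
by rewrite /fold_plus; case: ifP => // _; rewrite /imbalance signed_sum_flip sqrrN.
Qed.

Local Notation P := (@restricted_rss R beta n k).

Lemma expect_fold_invariant g (s : omega_plus R n) :
  (forall t, g (fold_plus R t) = g t) ->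
  expect P (g \o val) s = fresh_scan_mean beta k finset.set0 g (val s).
Proof.
move=> gf; rewrite (expect_restricted _ kn).
by congr (fresh_scan_mean _ _ _ _ _); apply/funext => t; rewrite /= gf.
Qed.

(** At stationarity the loss of a fraction [1 / n] of the squared imbalance per
    update balances the bounded gain. *)
Lemma stationary_sqr_imbalance mu : stationary_distribution P mu ->
  \sum_s mu s * imbalance (val s) ^+ 2 <= (4 + Ce ^+ 2) * n%:R.
Proof.
move=> st; have [mu0 mu1 _] := st.
set m2 := \sum_s _; set rho := 1 - (n%:R : R)^-1.
have rho0 : 0 <= rho by rewrite subr_ge0 invf_le1// ler1n; lia.
set S := \sum_(i < k) rho ^+ i.
have S0 : 0 < S.
  rewrite /S; case: (k) k_gt0 => // k' _; rewrite big_ord_recl expr0.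
  by rewrite ltr_pwDl// sumr_ge0// => i _; rewrite exprn_ge0.
have SE : 1 - rho ^+ k = S / n%:R.
  have := subrX1 rho k; rewrite -/S.
  have -> : rho - 1 = - n%:R^-1 by rewrite /rho; ring.
  by move=> h; rewrite -opprB h; ring.
have H : m2 <= rho ^+ k * m2 + (4 + Ce ^+ 2) * S.
  rewrite {1}/m2 -(stationary_expect ((fun t => imbalance t ^+ 2) \o val) st).
  have -> : (4 + Ce ^+ 2) * S = \sum_s mu s * ((4 + Ce ^+ 2) * S).
    by rewrite -mulr_suml mu1 mul1r.
  rewrite mulr_sumr -big_split/=.
  apply: ler_sum => s _; rewrite mulrCA -mulrDr ler_wpM2l//.
  rewrite expect_fold_invariant; last exact: imbalance_fold.
  by apply: scan_drift => // U t; exact: sqr_imbalance_drift.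
have : m2 * (S / n%:R) <= (4 + Ce ^+ 2) * S by rewrite -SE; lra.
by rewrite mulrCA [_ * S]mulrC (ler_pM2l S0) ler_pdivrMr.
Qed.

Lemma alternating_in_omega_plus : 0 <= magnetization R (alternating n).
Proof. by rewrite /magnetization sum_alternating mulr_ge0// invr_ge0. Qed.

(** The event that the squared imbalance is at most [4 * B * n], where [B * n]
    bounds its stationary mean, has stationary probability at least [3 / 4];
    started from the alternating configuration, with imbalance [n], the chain
    needs long to reach it. *)
Lemma worst_dist_lower mu m : stationary_distribution P mu ->
  3 / 4 - (17 + 4 * Ce ^+ 2) * (1 + (31 + Ce ^+ 2) / n%:R) ^+ (k * m) / n%:R
   <= worst_dist P mu m.
Proof.
move=> st; have [mu0 mu1 _] := st.
have Ce2 := sqr_ge0 Ce.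
set B := 4 + Ce ^+ 2. set rho := 1 + _ / _.
have rho0 : 0 <= rho by rewrite addr_ge0// divr_ge0//; lra.
pose g (s : omega_plus R n) : R := (imbalance (val s) ^+ 2 <= 4 * B * n%:R)%R%:R.
pose s0 : omega_plus R n := Sub (alternating n) alternating_in_omega_plus.
have g01 t : 0 <= g t <= 1 by rewrite /g ler0n lern1 leq_b1.
apply: le_trans (worst_dist_ge (restricted_sum1 _ kn) m s0 st g01).
have h1 : 3 / 4 <= \sum_t mu t * g t.
  have B4 : 0 < 4 * B * n%:R by rewrite !mulr_gt0// /B; lra.
  have : \sum_t mu t * (1 - imbalance (val t) ^+ 2 / (4 * B * n%:R)) <= \sum_t mu t * g t.
    apply: ler_sum => t _; rewrite ler_wpM2l// /g.
    case: (lerP (imbalance (val t) ^+ 2) (4 * B * n%:R)) => /= h.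
      by rewrite lerBlDr lerDl divr_ge0// ?sqr_ge0// ltW.
    by rewrite lerBlDr add0r ler_pdivlMr// mul1r ltW.
  under eq_bigr do rewrite mulrBr mulr1.
  rewrite sumrB mu1.
  under eq_bigr do rewrite mulrA.
  rewrite -mulr_suml.
  have : (\sum_s mu s * imbalance (val s) ^+ 2) / (4 * B * n%:R) <= 1 / 4.
    rewrite ler_pdivrMr//; apply: le_trans (stationary_sqr_imbalance st) _.
    rewrite -/B; lra.
  by lra.
have h2 : expect (step_pow P m) g s0 <=
    (17 + 4 * Ce ^+ 2) * rho ^+ (k * m) / n%:R.
  pose K : R := (17 + 4 * Ce ^+ 2) * n%:R.
  have K0 : 0 < K by rewrite mulr_gt0//; lra.
  apply: (@le_trans _ _ (expect (step_pow P m)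
     (fun t => K * (inverse_imbalance \o val) t + 0) s0)).
    apply: expect_le; first by move=> s t; apply: step_pow_ge0; exact: restricted_ge0.
    move=> t; rewrite addr0 /g /= /inverse_imbalance.
    have y0 := sqr_ge0 (imbalance (val t)); move: (_ ^+ 2) y0 => y y0.
    have Q0 : 0 < y + n%:R by rewrite ltr_wpDl.
    case: (lerP y (4 * B * n%:R)) => /= h; last by rewrite divr_ge0 ?ltW.
    rewrite ler_pdivlMr// mul1r /K; rewrite /B in h; lra.
  rewrite (expect_affine (step_pow_sum1 (restricted_sum1 _ kn) m)) addr0.
  have -> : (17 + 4 * Ce ^+ 2) * rho ^+ (k * m) / n%:R =
     K * (rho ^+ (k * m) / n%:R ^+ 2) by rewrite /K; field; rewrite lt0r_neq0.
  rewrite ler_pM2l//.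
  have := @expect_step_pow_le R _ P (restricted_ge0 _ kn) (restricted_sum1 _ kn) (rho ^+ k)
    (inverse_imbalance \o val) m s0 (exprn_ge0 _ rho0).
  move=> /(_ _)/le_trans; apply.
    move=> t; rewrite expect_fold_invariant; last first.
      by move=> u; rewrite /inverse_imbalance imbalance_fold.
    apply: le_trans (@scan_drift _ _ _ _ kn rho 0 inverse_imbalance (val t) rho0 _) _; first exact: inverse_imbalance_drift.
    by rewrite mul0r addr0.
  rewrite -exprM ler_wpM2l ?exprn_ge0//= /inverse_imbalance.
  have -> : imbalance (alternating n) = n%:R.
    rewrite /imbalance /signed_sum (eq_bigr (fun=> 1)); first by rewrite sumr_const card_ord.
    by move=> v _; rewrite spin_sqr.
  rewrite lef_pV2 ?posrE; last 2 first.
  - by rewrite addr_gt0// exprn_gt0.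
  - by rewrite exprn_gt0.
  by rewrite lerDl ltW.
by lra.
Qed.

End LowerBound.

(** Up to [c * n * ln n] updates with [c] small, the factor
    [(1 + O(1 / n)) ^+ (k * m)] is at most the square root of [n], which the
    denominator [n] in [worst_dist_lower] absorbs. *)
Lemma worst_dist_before_nlogn (R : realType) (beta : R) : 0 < beta ->
  exists c : R, exists N : nat, 0 < c /\
  forall (n k m : nat) (mu : omega_plus R n -> R), (N <= n)%N -> (0 < k)%N ->
    (k * k <= n)%N -> stationary_distribution (@restricted_rss R beta n k) mu ->
    m%:R * k%:R <= c * (n%:R * ln n%:R) ->
    1 / 4 < worst_dist (@restricted_rss R beta n k) mu m.
Proof.
move=> b0; set A : R := 31 + (beta + 6) ^+ 2; set C : R := 17 + 4 * (beta + 6) ^+ 2.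
have b2 := sqr_ge0 (beta + 6).
have A0 : 0 < A by rewrite /A; lra.
have C0 : 0 < C by rewrite /C; lra.
exists (2 * A)^-1, (Num.bound ((4 * C) ^+ 2)).+2; split.
  by rewrite invr_gt0 mulr_gt0.
move=> n k m mu Nn k0 kk st mk.
have n2 : (2 <= n)%N by apply: leq_trans Nn.
have n0 : 0 < (n%:R : R) by rewrite ltr0n; lia.
have k2 : (2 * k <= n)%N by nia.
have := worst_dist_lower b0 k0 k2 kk m st; apply: lt_le_trans.
rewrite -/A -/C.
set r : R := Num.sqrt n%:R.
have r0 : 0 < r by rewrite sqrtr_gt0.
have r2 : r * r = n%:R by rewrite -expr2 sqr_sqrtr// ltW.
have rC : 4 * C <= r.
  rewrite -(ger0_norm (ltW r0)) -[leLHS]ger0_norm; last by rewrite mulr_ge0// ltW.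
  rewrite -ler_sqr ?nnegrE// !real_normK ?num_real// [r ^+ 2]expr2 r2.
  apply: le_trans (ltW (archi_boundP _)) _; first by rewrite sqr_ge0.
  by rewrite ler_nat; exact: leq_trans (leqW (leqW (leqnn _))) Nn.
have H : (1 + A / n%:R) ^+ (k * m) <= r.
  apply: (@le_trans _ _ (expR (A / n%:R) ^+ (k * m))).
    by rewrite lerXn2r ?nnegrE ?expR_ge0// ?expR_ge1Dx// addr_ge0// divr_ge0// ltW.
  rewrite -expRM_natl -[leRHS]lnK ?posrE// ler_expR.
  have -> : ln r = ln n%:R / 2.
    by rewrite -r2 lnM ?posrE//; lra.
  rewrite natrM; apply: (@le_trans _ _ ((A / n%:R) * ((2 * A)^-1 * (n%:R * ln n%:R)))).
    by rewrite mulrC (ler_wpM2l (ltW (divr_gt0 A0 n0)))// mulrC.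
  by rewrite le_eqVlt; apply/orP; left; apply/eqP; field; rewrite !lt0r_neq0.
suff : C * (1 + A / n%:R) ^+ (k * m) / n%:R <= 1 / 4 by lra.
rewrite ler_pdivrMr//.
have : 0 <= (r - 4 * C) * r by rewrite mulr_ge0 ?(ltW r0)// subr_ge0.
have : C * (1 + A / n%:R) ^+ (k * m) <= C * r by rewrite ler_wpM2l// ltW.
lra.
Qed.

(** * Contraction of the Hamming distance *)

Lemma fresh_budget j p q k n : (j.+1 + p <= k)%N -> (k < n)%N -> (p + q = n)%N ->
  [/\ (j <= k)%N, (0 < q)%N & (q <= n)%N].
Proof. by move=> h1 h2 h3; split; lia. Qed.

Section HammingContraction.
Variables (R : realType) (beta : R) (n k : nat) (s0 L : R).
Implicit Types (s t : config n) (v : 'I_n) (U : {set 'I_n}) (F W : config n -> R).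
Hypothesis n_gt0 : (0 < n)%N.
Hypothesis L01 : 0 < L < 1.
Hypothesis tanh_contracts : forall x y, s0 <= x -> s0 <= y ->
  `|tanh (beta * x) - tanh (beta * y)| <= L * `|x - y|.

Definition differ s t v : R := (s v != t v)%:R.
Definition stale_hamming U s t : R := \sum_(v in U) differ s t v.
Definition fresh_hamming U s t : R := \sum_(v | v \notin U) differ s t v.
Definition hamming s t : R := \sum_v differ s t v.

Definition contraction_rate : R := (1 - L) / 2.
Local Notation c := contraction_rate.
Hypothesis k_small : 4 * k%:R <= c * n%:R.

Let nR : 0 < (n%:R : R). Proof. by rewrite ltr0n. Qed.

Lemma differ_ge0 s t v : 0 <= differ s t v. Proof. exact: ler0n. Qed.

Lemma hamming_split U s t : hamming s t = fresh_hamming U s t + stale_hamming U s t.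
Proof. by rewrite /fresh_hamming sum_fresh subrK. Qed.

Lemma fresh_hamming_ge0 U s t : 0 <= fresh_hamming U s t.
Proof. by rewrite sumr_ge0// => v _; exact: differ_ge0. Qed.

Lemma stale_hamming_ge0 U s t : 0 <= stale_hamming U s t.
Proof. by rewrite sumr_ge0// => v _; exact: differ_ge0. Qed.

Lemma stale_hamming_update U v s t b e : v \notin U ->
  stale_hamming (v |: U) (set_spin s v b) (set_spin t v e) =
  stale_hamming U s t + (b != e)%:R.
Proof.
move=> vU; rewrite /stale_hamming big_setU1//= addrC; congr (_ + _).
  apply: eq_bigr => w wU; have /negbTE wv : w != v by apply: contraNneq vU => <-.
  by rewrite /differ !ffunE wv.
by rewrite /differ !ffunE eqxx.
Qed.

Lemma fresh_hamming_update U v s t b e : v \notin U ->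
  fresh_hamming (v |: U) (set_spin s v b) (set_spin t v e) =
  fresh_hamming U s t - differ s t v.
Proof.
move=> vU; rewrite /fresh_hamming [in RHS](bigD1 v)//= addrAC subrr add0r.
apply: eq_big => [w|w]; rewrite !inE ?negb_or; first by rewrite andbC.
by move=> /andP[/negbTE wv _]; rewrite /differ !ffunE wv.
Qed.

Lemma normr_spin_sub b e : `|spin R b - spin R e| = 2 * (b != e)%:R.
Proof.
have h : `|2 : R| = 2 by rewrite normr_nat.
case: b; case: e; rewrite /spin/= ?subrr ?normr0 ?mulr0 ?mulr1//.
  by rewrite opprK.
by rewrite -opprD normrN.
Qed.

Lemma plus_prob_sub s t v : s0 + n%:R^-1 <= magnetization R s ->
  s0 + n%:R^-1 <= magnetization R t ->
  `|plus_prob beta s v - plus_prob beta t v| <= L / n%:R * hamming s t.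
Proof.
move=> ms mt; rewrite !plus_probE /local_tanh.
set x := magnetization R s - _; set y := magnetization R t - _.
have inv0 : 0 < (n%:R : R)^-1 by rewrite invr_gt0.
have spn b : spin R b / n%:R <= n%:R^-1.
  by rewrite -[leRHS]mul1r ler_pM2r// /spin; case: b; lra.
have hx : s0 <= x by have := spn (s v); rewrite /x; lra.
have hy : s0 <= y by have := spn (t v); rewrite /y; lra.
have -> : (1 + tanh (beta * x)) / 2 - (1 + tanh (beta * y)) / 2 =
  (tanh (beta * x) - tanh (beta * y)) / 2 by field.
rewrite normrM [`|2^-1|]gtr0_norm ?invr_gt0// ler_pdivrMr//.
apply: le_trans (tanh_contracts hx hy) _.
have -> : L / n%:R * hamming s t * 2 = L * (n%:R^-1 * (2 * hamming s t)) by ring.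
have [L0 _] := andP L01; rewrite ler_pM2l//.
have -> : x - y = n%:R^-1 * \sum_(w | w != v) (spin R (s w) - spin R (t w)).
  rewrite /x /y /magnetization (bigD1 v)//= [\sum_i spin R (t i)](bigD1 v)//=.
  by rewrite sumrB; ring.
rewrite normrM gtr0_norm// ler_pM2l//.
apply: le_trans (ler_norm_sum _ _ _) _.
rewrite /hamming [\sum_v0 _](bigD1 v)//= mulrDr.
rewrite -[leLHS]add0r lerD ?mulr_ge0 ?differ_ge0//.
rewrite mulr_sumr ler_sum// => w _.
by rewrite normr_spin_sub.
Qed.

Lemma magnetization_set_spin s v b :
  magnetization R s - 2 / n%:R <= magnetization R (set_spin s v b).
Proof.
rewrite !magnetizationE signed_sum_set_spin ffunE mul1r -mulrBl ler_pM2r ?invr_gt0//.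
by rewrite /spin; case: b; case: (s v); lra.
Qed.

(** This is the monotone coupling of two Bernoulli variables, in dual form: the
    outcomes disagree with probability [`|p - q|]. *)
Lemma bernoulli_coupling (p q X Y g1 g0 f1 f0 h1 h0 e1 e0 : R) :
  0 <= p <= 1 -> 0 <= q <= 1 ->
  g1 - f1 <= X + h1 + e1 -> g0 - f0 <= X + h0 + e0 ->
  g1 - f0 <= X + Y + h1 + e0 -> g0 - f1 <= X + Y + h0 + e1 ->
  (p * g1 + (1 - p) * g0) - (q * f1 + (1 - q) * f0) <=
  X + `|p - q| * Y + (p * h1 + (1 - p) * h0) + (q * e1 + (1 - q) * e0).
Proof.
move=> /andP[p0 p1] /andP[q0 q1] H11 H00 H10 H01.
have [pq|/ltW qp] := lerP p q.
  have A1 : 0 <= p * (X + h1 + e1 - (g1 - f1)) by rewrite mulr_ge0// subr_ge0.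
  have A2 : 0 <= (q - p) * (X + Y + h0 + e1 - (g0 - f1)) by rewrite mulr_ge0// subr_ge0.
  have A3 : 0 <= (1 - q) * (X + h0 + e0 - (g0 - f0)) by rewrite mulr_ge0// subr_ge0.
  by lra.
have A1 : 0 <= q * (X + h1 + e1 - (g1 - f1)) by rewrite mulr_ge0// subr_ge0.
have A2 : 0 <= (p - q) * (X + Y + h1 + e0 - (g1 - f0)) by rewrite mulr_ge0// subr_ge0.
have A3 : 0 <= (1 - p) * (X + h0 + e0 - (g0 - f0)) by rewrite mulr_ge0// subr_ge0.
by lra.
Qed.

(** A disagreement at a fresh vertex is worth less than 1, because the remaining
    updates may remove it; one at a used vertex stays for the rest of the scan
    and can only spread. *)
Definition fresh_weight (j : nat) : R := 1 - c * (j%:R / n%:R).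
Definition stale_weight (j : nat) : R := 1 + 2 * (j%:R / n%:R).

Let c0 : 0 < c. Proof. by rewrite /c; have := andP L01; case; lra. Qed.

Let ratio j : (j <= k)%N -> 0 <= j%:R / n%:R :> R /\ 4 * (j%:R / n%:R) <= c.
Proof.
move=> jk; split; first by rewrite divr_ge0.
rewrite mulrA ler_pdivrMr//; apply: le_trans k_small.
by rewrite ler_pM2l// ler_nat.
Qed.

Lemma fresh_weightS j : (j <= k)%N ->
  fresh_weight j * (1 - n%:R^-1) + stale_weight j * (L / n%:R) <= fresh_weight j.+1.
Proof.
move=> jk; have [x0 x1] := ratio jk.
have E : j.+1%:R / n%:R = j%:R / n%:R + n%:R^-1 :> R by rewrite -natr1 mulrDl mul1r.
rewrite /fresh_weight /stale_weight E; clear E.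
have inv0 : 0 < (n%:R : R)^-1 by rewrite invr_gt0.
move: x0 x1; move: (j%:R / n%:R) => x x0 x1; move: (n%:R^-1) inv0 => i i0.
rewrite -subr_ge0.
have [L0 L1] := andP L01.
have cE : L = 1 - 2 * c by rewrite /c; field.
have -> : 1 - c * (x + i) - ((1 - c * x) * (1 - i) + (1 + 2 * x) * (L * i)) =
  i * (c - c * x - 2 * L * x) by rewrite cE; ring.
apply: mulr_ge0; first exact: ltW.
have c1 : c <= 1 by rewrite cE in L0; lra.
have : c * x <= x by rewrite ler_piMl.
have : L * x <= x by rewrite ler_piMl// ltW.
by lra.
Qed.

Lemma stale_weightS j : (j <= k)%N ->
  stale_weight j * (1 + L / n%:R) <= stale_weight j.+1.
Proof.
move=> jk; have [x0 x1] := ratio jk.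
have E : j.+1%:R / n%:R = j%:R / n%:R + n%:R^-1 :> R by rewrite -natr1 mulrDl mul1r.
rewrite /stale_weight E; clear E.
have inv0 : 0 < (n%:R : R)^-1 by rewrite invr_gt0.
move: x0 x1; move: (j%:R / n%:R) => x x0 x1; move: (n%:R^-1) inv0 => i i0.
rewrite -subr_ge0.
have [L0 L1] := andP L01.
have -> : 1 + 2 * (x + i) - (1 + 2 * x) * (1 + L * i) =
  i * (2 - L - 2 * (L * x)) by ring.
apply: mulr_ge0; first exact: ltW.
have : L * x <= x by rewrite ler_piMl// ltW.
have : c <= 1 / 2 by rewrite /c; lra.
by lra.
Qed.

Lemma fresh_weight_ge0 j : (j <= k)%N -> 0 <= fresh_weight j.
Proof.
move=> jk; have [x0 x1] := ratio jk; rewrite /fresh_weight.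
have [L0 L1] := andP L01.
have c1 : c <= 1 by rewrite /c; lra.
have : c * (j%:R / n%:R) <= j%:R / n%:R by rewrite ler_piMl.
lra.
Qed.

Lemma stale_weight_ge0 j : 0 <= stale_weight j.
Proof. by rewrite /stale_weight addr_ge0// mulr_ge0// divr_ge0. Qed.

(** Both copies update the same vertices.  An update at a uniform fresh vertex
    removes a fresh disagreement with probability at least [1 / n] each, and
    creates one with probability at most [L / n] per existing disagreement; with
    [L < 1] the removals win.  The hypotheses on the magnetization leave room
    for [j] more updates to lower it by [2 / n] each before it drops below [s0].
    The terms [W] are carried along so that the contraction can be combined with
    potentials of the two copies. *)
Lemma fresh_scan_contracts (C : R) F W j U s t : 0 <= C -> (j + #|U| <= k)%N -> (k < n)%N ->
  (forall s t, s0 <= magnetization R s -> s0 <= magnetization R t ->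
     F s - F t <= C * hamming s t + W s + W t) ->
  s0 + (2 * j + 1)%:R / n%:R <= magnetization R s ->
  s0 + (2 * j + 1)%:R / n%:R <= magnetization R t ->
  fresh_scan_mean beta j U F s - fresh_scan_mean beta j U F t <=
   C * (fresh_weight j * fresh_hamming U s t + stale_weight j * stale_hamming U s t)
   + fresh_scan_mean beta j U W s + fresh_scan_mean beta j U W t.
Proof.
move=> C0 + kn FW.
have inv0 : 0 < (n%:R : R)^-1 by rewrite invr_gt0.
elim: j U s t => [|j IH] U s t jU ms mt /=.
  have -> : fresh_weight 0 = 1 by rewrite /fresh_weight mul0r mulr0 subr0.
  have -> : stale_weight 0 = 1 by rewrite /stale_weight mul0r mulr0 addr0.
  rewrite !mul1r -hamming_split; apply: FW; apply: le_trans; [|exact: ms| |exact: mt].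
  - by rewrite lerDl mulr_ge0// ltW.
  - by rewrite lerDl mulr_ge0// ltW.
have cU := cardsC U; rewrite card_ord in cU.
have [jk U0 Un] := fresh_budget jU kn cU.
set a := fresh_weight j; set b := stale_weight j.
have a0 : 0 <= a := fresh_weight_ge0 jk.
have b0 : 0 <= b := stale_weight_ge0 j.
set fr := fresh_hamming U s t; set st := stale_hamming U s t.
have fr0 : 0 <= fr := fresh_hamming_ge0 U s t.
have st0 : 0 <= st := stale_hamming_ge0 U s t.
have [K KE] : exists K, K = C * (a * fr + b * st) + L / n%:R * (fr + st) * (C * b).
  by eexists.
rewrite -mulrBl -sumrB.
apply: (@le_trans _ _ ((\sum_(v | v \notin U) (K + - (C * a) * differ s t v +
    update_mean beta v (fresh_scan_mean beta j (v |: U) W) s +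
    update_mean beta v (fresh_scan_mean beta j (v |: U) W) t)) / #|~: U|%:R)).
  apply: fresh_mean_le => v vU.
  have jU' : (j + #|v |: U| <= k)%N by rewrite cardsU1 vU add1n addnS -addSn.
  have step x e : s0 + (2 * j.+1 + 1)%:R / n%:R <= magnetization R x ->
      s0 + (2 * j + 1)%:R / n%:R <= magnetization R (set_spin x v e).
    move=> h; apply: le_trans (magnetization_set_spin x v e).
    rewrite lerBrDr; apply: le_trans h; rewrite -addrA lerD2l -mulrDl.
    by rewrite ler_pM2r// -natrD ler_nat mulnS [X in (X <= _)%N]addnC addnA.
  have D e f := IH (v |: U) (set_spin s v e) (set_spin t v f) jU' (step _ e ms) (step _ f mt).
  move: (D true true) (D false false) (D true false) (D false true).
  rewrite !fresh_hamming_update// !stale_hamming_update//= -/fr -/st -/a -/b !addr0.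
  move=> D11 D00 D10 D01.
  have p01 x : 0 <= plus_prob beta x v <= 1.
    by rewrite !ltW ?plus_prob_gt0 ?plus_prob_lt1.
  have := @bernoulli_coupling (plus_prob beta s v) (plus_prob beta t v)
    (C * (a * (fr - differ s t v) + b * st)) (C * b) _ _ _ _ _ _ _ _ (p01 s) (p01 t)
    D11 D00 _ _.
  rewrite /update_mean => /(_ _ _)/le_trans -> //.
  - by apply: le_trans D10 _; rewrite le_eqVlt; apply/orP; left; apply/eqP; ring.
  - by apply: le_trans D01 _; rewrite le_eqVlt; apply/orP; left; apply/eqP; ring.
  rewrite !lerD2r KE.
  have hn (x : config n) : s0 + (2 * j.+1 + 1)%:R / n%:R <= magnetization R x ->
      s0 + n%:R^-1 <= magnetization R x.
    by apply: le_trans; rewrite lerD2l -[leLHS]mul1r ler_pM2r// ler1n addn1.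
  have := plus_prob_sub v (hn _ ms) (hn _ mt); rewrite (hamming_split U) -/fr -/st => pp.
  have : 0 <= C * b by rewrite mulr_ge0.
  move=> /ler_wpM2r/(_ _ _ pp).
  by lra.
have := fresh_weightS jk; have := stale_weightS jk.
move: (fresh_weight j.+1) (stale_weight j.+1) => a' b'; rewrite -/a -/b => hb ha.
rewrite !big_split/= -mulr_sumr -/(fresh_hamming U s t) -/fr !mulrDl !lerD2r.
rewrite fresh_mean_cst//.
have frn : a * (fr / n%:R) <= a * (fr / #|~: U|%:R).
  by rewrite ler_wpM2l// ler_wpM2l// lef_pV2 ?posrE ?ltr0n// ler_nat.
have wa : 0 <= C * fr * (a' - (a * (1 - n%:R^-1) + b * (L / n%:R))).
  by rewrite (mulr_ge0 (mulr_ge0 C0 fr0))// subr_ge0.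
have wb : 0 <= C * st * (b' - b * (1 + L / n%:R)).
  by rewrite (mulr_ge0 (mulr_ge0 C0 st0))// subr_ge0.
have wc : 0 <= C * (a * (fr / #|~: U|%:R) - a * (fr / n%:R)).
  by rewrite mulr_ge0// subr_ge0.
rewrite KE; lra.
Qed.

End HammingContraction.

(** * Escape from zero magnetization *)

Section EscapeAlgebra.
Variable R : realType.
Implicit Types (w eta z D N K : R).

Lemma pos_part_quartic w eta :
  Num.max 0 (w + eta) ^+ 4 <=
  w ^+ 4 + 4 * w ^+ 3 * eta + 8 * w ^+ 2 * eta ^+ 2 + 3 * eta ^+ 4.
Proof.
have E : w ^+ 4 + 4 * w ^+ 3 * eta + 8 * w ^+ 2 * eta ^+ 2 + 3 * eta ^+ 4 =
   (w + eta) ^+ 4 + 2 * (eta * (w - eta)) ^+ 2 by ring.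
rewrite E; have h : 0 <= 2 * (eta * (w - eta)) ^+ 2 by rewrite mulr_ge0// sqr_ge0.
case: (leP 0 (w + eta)) => H; first by rewrite lerDl.
by rewrite expr0n/= addr_ge0// exprn_even_ge0.
Qed.

Lemma pos_part_quartic_neg w eta : w <= 0 -> Num.max 0 (w + eta) ^+ 4 <= eta ^+ 4.
Proof.
move=> w0; case: (leP 0 (w + eta)) => H; last by rewrite expr0n/= exprn_even_ge0.
by rewrite lerXn2r// ?nnegrE//; lra.
Qed.

(** With [z = n * S] and [N = n] this is [(S ^+ 2 + K / n)^-1]: it is of order [n]
    where the magnetization [S] is within its fluctuations of 0, and bounded
    where [S] is bounded away from 0. *)
Definition inv_sqr_potential N K z : R := N ^+ 2 / (z ^+ 2 + K * N).

(** Writing [Q] and [Q'] for the denominators, the increment [eta] is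
    [- kap * (Q' - Q) * (Q / Q')], and [Q <= 2 * Q'].  In the first bound
    the term [- D ^+ 2] comes with a coefficient close to 1 when [K] is large: it is
    the gain from the noise, the only source of decay near [z = 0]. *)
Lemma inv_sqr_potential_step N K z D : 0 < N -> 8 <= K * N -> D ^+ 2 <= 4 ->
  let kap := inv_sqr_potential N K z ^+ 2 / N ^+ 2 in
  let eta := inv_sqr_potential N K (z + D) - inv_sqr_potential N K z in
  eta <= kap * (- 2 * z * D - D ^+ 2 * (1 - 8 * (z ^+ 2 + 1) / (K * N))) /\
  eta ^+ 2 <= 128 * kap ^+ 2 * (z ^+ 2 + 1).
Proof.
move=> N0 KN D4 /=; rewrite /inv_sqr_potential.
set Q := z ^+ 2 + K * N; set Q' := (z + D) ^+ 2 + K * N.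
have z2 := sqr_ge0 z; have zD2 := sqr_ge0 (z + D); have D2 := sqr_ge0 D.
have Q0 : 0 < Q by rewrite /Q; lra.
have Q'0 : 0 < Q' by rewrite /Q'; lra.
have kapE : (N ^+ 2 / Q) ^+ 2 / N ^+ 2 = N ^+ 2 / Q ^+ 2 by field; rewrite !lt0r_neq0.
rewrite kapE; set kap := N ^+ 2 / Q ^+ 2.
have kap0 : 0 < kap by rewrite divr_gt0// exprn_gt0.
have QQ : Q <= 2 * Q'.
  have h : 0 <= (z + 2 * D) ^+ 2 := sqr_ge0 _.
  have -> : 2 * Q' = Q + (z + 2 * D) ^+ 2 - 2 * D ^+ 2 + K * N by rewrite /Q /Q'; ring.
  lra.
have zDD : (2 * z + D) ^+ 2 <= 8 * (z ^+ 2 + 1).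
  have h : 0 <= (2 * z - D) ^+ 2 := sqr_ge0 _.
  have -> : (2 * z + D) ^+ 2 = 8 * z ^+ 2 + 2 * D ^+ 2 - (2 * z - D) ^+ 2 by ring.
  lra.
have etaE : N ^+ 2 / Q' - N ^+ 2 / Q = - kap * (D * (2 * z + D)) * (Q / Q').
  have E : D * (2 * z + D) = Q' - Q by rewrite /Q /Q'; ring.
  by rewrite E /kap; field; rewrite !lt0r_neq0.
rewrite etaE; split.
  have -> : - kap * (D * (2 * z + D)) * (Q / Q') =
     kap * (- 2 * z * D - D ^+ 2 * (1 - (2 * z + D) ^+ 2 / Q')).
    have E : Q / Q' = 1 - D * (2 * z + D) / Q'.
      have E : D * (2 * z + D) = Q' - Q by rewrite /Q /Q'; ring.
      by rewrite E; field; rewrite !lt0r_neq0.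
    by rewrite E; ring.
  rewrite ler_pM2l// lerD2l lerN2 ler_wpM2l// lerD2l lerN2.
  apply: (@le_trans _ _ ((2 * z + D) ^+ 2 / (K * N))).
    by rewrite ler_wpM2l ?sqr_ge0// lef_pV2 ?posrE//; [rewrite /Q'; lra|lra].
  by rewrite ler_wpM2r ?invr_ge0//; lra.
have -> : (- kap * (D * (2 * z + D)) * (Q / Q')) ^+ 2 =
   kap ^+ 2 * (D ^+ 2 * (2 * z + D) ^+ 2 * (Q / Q') ^+ 2) by ring.
have -> : 128 * kap ^+ 2 * (z ^+ 2 + 1) = kap ^+ 2 * (4 * (8 * (z ^+ 2 + 1)) * 4) by ring.
rewrite ler_pM2l ?exprn_gt0//.
apply: ler_pM; [exact: mulr_ge0 (sqr_ge0 _) (sqr_ge0 _)|exact: sqr_ge0| |].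
  by apply: ler_pM => //; exact: sqr_ge0.
have q0 : 0 <= Q / Q' by rewrite ltW// divr_gt0.
have q2 : Q / Q' <= 2 by rewrite ler_pdivrMr.
by move: q0 q2; move: (Q / Q') => q; nra.
Qed.

(** Either [a1 * b <= c1 * w], and [w ^+ 3] absorbs the part of [T] from [b], or [w]
    is itself at most a multiple of [b]. *)
Lemma quadratic_correction (a1 K c1 w b T : R) :
  0 <= a1 -> 0 < c1 -> 0 < K -> 0 <= w -> 0 <= b -> 2 * a1 <= c1 * K ->
  T <= 2 * K^-1 * w + b ->
  a1 * w ^+ 2 * T <= 2 * c1 * w ^+ 3 + a1 ^+ 3 / c1 ^+ 2 * b ^+ 3.
Proof.
move=> a10 c10 K0 w0 b0 cK Tb.
have nc : c1 != 0 by rewrite lt0r_neq0.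
have w3 : 0 <= w ^+ 3 by rewrite exprn_ge0.
have b3 : 0 <= b ^+ 3 by rewrite exprn_ge0.
have A1 : a1 * w ^+ 2 * T <= 2 * a1 * K^-1 * w ^+ 3 + a1 * w ^+ 2 * b.
  have : 0 <= a1 * w ^+ 2 * (2 * K^-1 * w + b - T).
    by rewrite mulr_ge0 ?subr_ge0// mulr_ge0// sqr_ge0.
  lra.
have A2 : 2 * a1 * K^-1 * w ^+ 3 <= c1 * w ^+ 3.
  by rewrite ler_wpM2r// ler_pdivrMr.
have A3 : a1 * w ^+ 2 * b <= c1 * w ^+ 3 + a1 ^+ 3 / c1 ^+ 2 * b ^+ 3.
  have [wb|/ltW wb] := lerP (a1 * b) (c1 * w).
    have : 0 <= w ^+ 2 * (c1 * w - a1 * b) by rewrite mulr_ge0 ?sqr_ge0// subr_ge0.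
    have : 0 <= a1 ^+ 3 / c1 ^+ 2 * b ^+ 3 by rewrite mulr_ge0// divr_ge0 ?sqr_ge0// exprn_ge0.
    lra.
  have wb' : w <= a1 / c1 * b by rewrite mulrAC ler_pdivlMr// mulrC.
  have ab0 : 0 <= a1 / c1 * b by rewrite mulr_ge0// divr_ge0// ltW.
  have : w ^+ 2 <= (a1 / c1 * b) ^+ 2 by rewrite lerXn2r ?nnegrE.
  move=> /(ler_wpM2r b0)/(ler_wpM2l a10).
  have -> : a1 * ((a1 / c1 * b) ^+ 2 * b) = a1 ^+ 3 / c1 ^+ 2 * b ^+ 3 by field.
  have : 0 <= c1 * w ^+ 3 by rewrite mulr_ge0// ltW.
  lra.
lra.
Qed.

Lemma quartic_correction (a2 K c1 w b v0 T h : R) :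
  0 <= a2 -> 0 < c1 -> 2 <= K -> 0 <= w -> 0 <= b -> 0 < v0 -> 0 <= T ->
  8 * a2 <= v0 * c1 * K -> h * v0 <= T -> T <= 2 * K^-1 * w + b ->
  a2 * (T ^+ 2 * h) <= c1 * w ^+ 3 + 4 * a2 / v0 * b ^+ 3.
Proof.
move=> a20 c10 K2 w0 b0 v00 T0 vcK hT Tb.
have K0 : 0 < K by lra.
have nK : K != 0 by rewrite lt0r_neq0.
have nv : v0 != 0 by rewrite lt0r_neq0.
have iK : 0 < K^-1 by rewrite invr_gt0.
have w3 : 0 <= w ^+ 3 by rewrite exprn_ge0.
have B1 : T ^+ 2 * h <= T ^+ 3 / v0.
  by rewrite ler_pdivlMr// -mulrA [T ^+ 3]exprSr ler_wpM2l ?sqr_ge0.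
have B2 : T ^+ 3 <= 4 * (2 * K^-1 * w) ^+ 3 + 4 * b ^+ 3.
  have u0 : 0 <= 2 * K^-1 * w by rewrite !mulr_ge0// ltW.
  apply: (@le_trans _ _ ((2 * K^-1 * w + b) ^+ 3)).
    by rewrite lerXn2r ?nnegrE// addr_ge0.
  move: (2 * K^-1 * w) u0 => u u0.
  have : 0 <= 3 * ((u + b) * (u - b) ^+ 2) by rewrite mulr_ge0// mulr_ge0 ?sqr_ge0// addr_ge0.
  by lra.
have B3 : a2 / v0 * (4 * (2 * K^-1 * w) ^+ 3) <= c1 * w ^+ 3 * (4 * K^-1 ^+ 2).
  have -> : a2 / v0 * (4 * (2 * K^-1 * w) ^+ 3) =
     (8 * a2 / (v0 * K)) * w ^+ 3 * (4 * K^-1 ^+ 2) by field; rewrite nK nv.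
  have k4 : 0 <= 4 * K^-1 ^+ 2 by rewrite mulr_ge0// exprn_ge0// ltW.
  rewrite (ler_wpM2r k4)// (ler_wpM2r w3)// ler_pdivrMr ?mulr_gt0//; lra.
have B4 : 4 * K^-1 ^+ 2 <= 1.
  have : K^-1 <= 2^-1 by rewrite lef_pV2 ?posrE.
  by move: (K^-1) iK => i i0; nra.
have B5 : c1 * w ^+ 3 * (4 * K^-1 ^+ 2) <= c1 * w ^+ 3.
  by rewrite ler_piMr// mulr_ge0// ltW.
have B6 : a2 * (T ^+ 2 * h) <= a2 / v0 * (4 * (2 * K^-1 * w) ^+ 3 + 4 * b ^+ 3).
  apply: (@le_trans _ _ (a2 * (T ^+ 3 / v0))); first by rewrite ler_wpM2l.
  by rewrite [T ^+ 3 / _]mulrC mulrA ler_wpM2l// divr_ge0// ltW.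
lra.
Qed.

Lemma le_1addX4 (w : R) : 0 <= w -> w <= 1 + w ^+ 4.
Proof.
move=> w0; have [w1|w1] := lerP w 1; first by have := exprn_ge0 4 w0; lra.
have h1 : 1 <= w ^+ 3 by rewrite exprn_ege1// ltW.
by have : w * 1 <= w * w ^+ 3; [rewrite ler_wpM2l|rewrite -exprS; lra].
Qed.

(** The first-order term carries [w ^+ 3 * (kap * g)].  The corrections are smaller by
    the ratio [T / w] with [T = (w + v0) ^+ 2 / N], and [T] is at most
    [2 * w / K + v0 ^+ 2 / N]: for large [K] the first part is absorbed, and the
    second part matters only when [w] is of order [1 / N], where everything is of
    order [N ^- 4]. *)
Lemma escape_balance (a1 a2 N K v0 c1 w g kap : R) : 0 <= a1 -> 0 <= a2 ->
  1 <= N -> 2 <= K -> 0 < v0 -> 0 < c1 -> 0 <= w -> 0 <= g ->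
  kap * N ^+ 2 = (w + v0) ^+ 2 ->
  w + v0 <= N / K ->
  kap * g <= (w + v0) / N -> (w + v0) / (K * N) <= kap * g ->
  K * v0 <= N -> 2 * a1 <= c1 * K -> 8 * a2 <= v0 * c1 * K ->
  let C3 := (a1 ^+ 3 / c1 ^+ 2 + 4 * a2 / v0) * v0 ^+ 6 in
  C3 * K <= c1 * N ->
  w ^+ 4 - 8 * c1 * w ^+ 3 * (kap * g) + a1 * w ^+ 2 * (kap ^+ 2 * (N * g))
    + a2 * (kap ^+ 2 * (N * g)) ^+ 2 <=
  (1 - c1 / K / N) * w ^+ 4 + C3 * (1 + v0) / N ^+ 4.
Proof.
move=> a10 a20 N1 K1 v00 c10 w0 g0 kapE wN kgU kgL KvN cK vcK C3 C3N.
have N0 : 0 < N by lra. have K0 : 0 < K by lra.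
have nN : N != 0 by rewrite lt0r_neq0. have nK : K != 0 by rewrite lt0r_neq0.
have nc : c1 != 0 by rewrite lt0r_neq0. have nv : v0 != 0 by rewrite lt0r_neq0.
set h := kap * g in kgU kgL *.
have h0 : 0 <= h by apply: le_trans kgL; rewrite divr_ge0//; [lra|rewrite mulr_ge0//; lra].
pose T := (w + v0) ^+ 2 / N.
have T0 : 0 <= T by rewrite divr_ge0 ?sqr_ge0// ltW.
have kT : kap * N = T by rewrite /T -kapE; field.
have -> : kap ^+ 2 * (N * g) = h * T by rewrite -kT /h; ring.
pose b := v0 ^+ 2 / N.
have b0 : 0 <= b by rewrite divr_ge0 ?sqr_ge0// ltW.
have Tb : T <= 2 * K^-1 * w + b.
  have e1 : T = w * ((w + v0) / N) + v0 * w / N + b by rewrite /T /b; field.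
  have e2 : (w + v0) / N <= K^-1 by rewrite ler_pdivrMr// mulrC.
  have e3 : v0 / N <= K^-1 by rewrite ler_pdivrMr// mulrC ler_pdivlMr// mulrC.
  have : w * ((w + v0) / N) <= w * K^-1 by rewrite ler_wpM2l.
  have : w * (v0 / N) <= w * K^-1 by rewrite ler_wpM2l.
  rewrite e1; lra.
have iK : 0 < K^-1 by rewrite invr_gt0.
have iK1 : K^-1 <= 1 by rewrite invf_le1//; lra.
have w3 : 0 <= w ^+ 3 by rewrite exprn_ge0.
have b3 : 0 <= b ^+ 3 by rewrite exprn_ge0.
have Q1 := quadratic_correction a10 c10 K0 w0 b0 cK Tb.
have hT : h * v0 <= T.
  have h1 : h * v0 <= h * (w + v0) by rewrite ler_wpM2l// lerDr.
  have h2 : h * (w + v0) <= (w + v0) / N * (w + v0).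
    by rewrite ler_wpM2r// addr_ge0// ltW.
  apply: le_trans h1 (le_trans h2 _).
  by rewrite /T expr2 mulrAC.
have Q2 := quartic_correction a20 c10 K1 w0 b0 v00 T0 vcK hT Tb.
have S : w ^+ 4 - 8 * c1 * w ^+ 3 * h + a1 * w ^+ 2 * (h * T) + a2 * (h * T) ^+ 2
   <= w ^+ 4 + h * (- 5 * c1 * w ^+ 3 + (a1 ^+ 3 / c1 ^+ 2 + 4 * a2 / v0) * b ^+ 3).
  have H1 := ler_wpM2l h0 Q1; have H2 := ler_wpM2l h0 Q2; lra.
apply: le_trans S _.
set C2 := a1 ^+ 3 / c1 ^+ 2 + 4 * a2 / v0 in C3 C3N *.
have C20 : 0 <= C2.
  by apply: addr_ge0; apply: divr_ge0; rewrite ?exprn_ge0 ?mulr_ge0 ?(ltW c10) ?(ltW v00).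
have C30 : 0 <= C3 by rewrite mulr_ge0// exprn_ge0// ltW.
have L1 : c1 / K / N * w ^+ 4 <= c1 * w ^+ 3 * h.
  have : 0 <= c1 * w ^+ 3 * (h - w / (K * N)).
    rewrite mulr_ge0 ?mulr_ge0 ?(ltW c10)// subr_ge0; apply: le_trans kgL.
    by rewrite ler_wpM2r ?lerDl ?invr_ge0 ?ltW// mulr_gt0.
  have -> : c1 / K / N * w ^+ 4 = c1 * w ^+ 3 * (w / (K * N)).
    by field; rewrite ?nK ?nN.
  lra.
have C2b : C2 * b ^+ 3 * N ^+ 3 = C3 by rewrite /b /C3; field.
have L2 : h * (C2 * b ^+ 3) <= C3 * (w + v0) / N ^+ 4.
  have : h * (C2 * b ^+ 3) <= (w + v0) / N * (C2 * b ^+ 3).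
    by rewrite ler_wpM2r// mulr_ge0.
  have -> : C3 * (w + v0) / N ^+ 4 = (w + v0) / N * (C2 * b ^+ 3).
    by rewrite -C2b; field.
  by [].
have w14 := le_1addX4 w0.
have L3 : C3 * (w + v0) / N ^+ 4 <= C3 * (1 + v0) / N ^+ 4 + c1 / K / N * w ^+ 4.
  have G1 : C3 * (w + v0) / N ^+ 4 <= C3 * (1 + w ^+ 4 + v0) / N ^+ 4.
    by rewrite ler_wpM2r ?invr_ge0 ?exprn_ge0 ?(ltW N0)// ler_wpM2l// lerD2r.
  have G2 : C3 / N ^+ 4 <= c1 / K / N.
    rewrite -mulrA -invfM ler_pdivlMr ?mulr_gt0// mulrAC ler_pdivrMr ?exprn_gt0//.
    have : C3 * K * N <= c1 * N * N by rewrite ler_wpM2r// ltW.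
    have : c1 * N * N <= c1 * N ^+ 4.
      rewrite -mulrA ler_wpM2l ?(ltW c10)// -expr2.
      by rewrite ler_weXn2l.
    by lra.
  have : C3 / N ^+ 4 * w ^+ 4 <= c1 / K / N * w ^+ 4 by rewrite ler_wpM2r// exprn_ge0.
  lra.
have M0 : 0 <= c1 * w ^+ 3 * h by rewrite (mulr_ge0 (mulr_ge0 (ltW c10) w3)).
lra.
Qed.
End EscapeAlgebra.

Section EscapeDrift.
Variables (R : realType) (beta : R) (n k : nat) (s1 gamma c1 K : R).
Implicit Types (s : config n) (v : 'I_n) (U : {set 'I_n}).
Hypotheses (beta_gt0 : 0 < beta) (k_gt0 : (0 < k)%N) (k2n : (2 * k <= n)%N).
Hypotheses (s1_gt0 : 0 < s1)
  (tanh_repels : forall x, 0 <= x <= s1 -> (1 + gamma) * x <= tanh (beta * x)).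
Local Notation N := (n%:R : R).

Definition threshold : R := (s1 ^+ 2)^-1.
Local Notation v0 := threshold.

Definition escape_excess s : R :=
  inv_sqr_potential N K (signed_sum R (all_plus n) s) - v0.

(** The truncation makes the potential vanish for magnetizations above [s1]; the
    fourth power makes it so flat there that one update leaks only
    [O(n ^- 4)] back; this stays small after the potential gets a weight of order
    [n ^+ 2] and after accumulation over all updates. *)
Definition escape_potential s : R := Num.max 0 (escape_excess s) ^+ 4.

Definition escape_const : R :=
  ((8 * 128) ^+ 3 / c1 ^+ 2 + 4 * (3 * 128 ^+ 2) / v0) * v0 ^+ 6.

Definition escape_leak : R :=
  escape_const * (1 + v0) + (256 * v0 ^+ 4) ^+ 2.

Hypotheses (c1_gt0 : 0 < c1) (c1_gamma : 4 * c1 <= 2 * gamma)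
  (c1_flip : 4 * c1 <= flip_floor beta)
  (error_small : N * ((beta + 4) * (k%:R / N)) ^+ 2 <= c1 ^+ 2).
Hypotheses (K8 : 8 <= K) (K32 : 32 <= c1 * K)
  (Ka1 : 2 * (8 * 128) <= c1 * K) (Ka2 : 8 * (3 * 128 ^+ 2) <= v0 * c1 * K).
Hypotheses (N_v0 : K * v0 <= N) (N_const : escape_const * K <= c1 * N).

Let N1 : 1 <= N. Proof. by rewrite ler1n; move: k_gt0 k2n; clear; lia. Qed.
Let N0 : 0 < N. Proof. exact: lt_le_trans ltr01 N1. Qed.
Let kn : (k <= n)%N. Proof. by move: k2n; clear; lia. Qed.
Let v0_gt0 : 0 < v0. Proof. by rewrite invr_gt0 exprn_gt0. Qed.
Let K0 : 0 < K. Proof. by have h := K8; lra. Qed.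
Let KN8 : 8 <= K * N. Proof. by have := ler_wpM2l (ltW K0) N1; have := K8; lra. Qed.

(** With [z] the sum of the spins, the drift of [z ^+ 2] is at least of order
    [z ^+ 2 / n + 1]: the first term from the repulsion at 0, the second from the
    noise.  The error of size [O(k / n)] in the drift of [z] is split by
    [2 * a * b <= a ^+ 2 + b ^+ 2] into parts of each; this needs [k ^+ 2] small
    against [n]. *)
Lemma escape_drift_term U s : (#|U| < k)%N -> 0 <= escape_excess s ->
  2 * c1 * (signed_sum R (all_plus n) s ^+ 2 / N + 1) <=
  2 * (signed_sum R (all_plus n) s * fresh_drift beta U (all_plus n) s)
  + fresh_square beta U s * (1 - 8 * (signed_sum R (all_plus n) s ^+ 2 + 1) / (K * N)).
Proof.
move=> Uk; rewrite /escape_excess /inv_sqr_potential /=.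
have [n1 n0 kn8 vv0] := And4 N1 N0 KN8 v0_gt0.
have [cc0 cg cf kk8] := And4 c1_gt0 c1_gamma c1_flip K8.
have U0 := card_fresh_gt0 Uk kn.
have := fresh_drift_approx (all_plus n) s beta_gt0 Uk k2n.
rewrite fresh_sign_all_plus// mulr1 magnetizationE.
have /andP[] := fresh_square_bounds s beta_gt0 U0.
move: (fresh_drift _ _ _ _) (fresh_square _ _ _) => d q.
set z := signed_sum R _ s => q0 q4 dd w0.
have z2 := sqr_ge0 z.
have zs : z ^+ 2 <= s1 ^+ 2 * N ^+ 2.
  have Q0 : 0 < z ^+ 2 + K * N by lra.
  move: w0; rewrite subr_ge0 /threshold ler_pdivlMr// mulrC ler_pdivrMr ?exprn_gt0//.
  by lra.
have zs1 : `|z / N| <= s1.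
  rewrite normrM normfV normr_nat ler_pdivrMr//.
  rewrite -(@ler_pXn2r _ 2)// ?nnegrE ?mulr_ge0 ?(ltW s1_gt0)//.
  by rewrite real_normK ?num_real// exprMn.
have drift : (1 + gamma) * (z ^+ 2 / N) <= z * tanh (beta * (z / N)).
  have [zp|zn] := lerP 0 z.
    have : 0 <= z / N <= s1.
      by rewrite divr_ge0//=; move: zs1; rewrite ger0_norm// divr_ge0.
    move=> /tanh_repels/(ler_wpM2l zp).
    by rewrite (_ : z * ((1 + gamma) * (z / N)) = (1 + gamma) * (z ^+ 2 / N))//; ring.
  have zn' : 0 <= - z by rewrite oppr_ge0 ltW.
  have : 0 <= - z / N <= s1.
    rewrite divr_ge0//=; move: zs1; rewrite -normrN -mulNr ger0_norm// divr_ge0//.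
  move=> /tanh_repels/(ler_wpM2l zn').
  rewrite (_ : beta * (- z / N) = - (beta * (z / N))); last by ring.
  rewrite tanhN mulrNN.
  by rewrite (_ : - z * ((1 + gamma) * (- z / N)) = (1 + gamma) * (z ^+ 2 / N))//; ring.
have es := error_small; set E := (beta + 4) * (k%:R / N) in es dd.
have err : 2 * (`|z| * E) <= c1 * (z ^+ 2 / N) + c1.
  have h : 0 <= (c1 * `|z| - N * E) ^+ 2 := sqr_ge0 _.
  have zz : `|z| ^+ 2 = z ^+ 2 by rewrite real_normK ?num_real.
  have e2 : (c1 * `|z| - N * E) ^+ 2 =
     c1 ^+ 2 * z ^+ 2 - 2 * c1 * N * (`|z| * E) + N * (N * E ^+ 2).
    by rewrite -zz; ring.
  have h2 : N * (N * E ^+ 2) <= N * c1 ^+ 2 by rewrite ler_pM2l.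
  have cN : 0 < c1 * N by rewrite mulr_gt0.
  rewrite -(ler_pM2l cN).
  have -> : c1 * N * (c1 * (z ^+ 2 / N) + c1) = c1 ^+ 2 * z ^+ 2 + N * c1 ^+ 2.
    by field; rewrite lt0r_neq0.
  by lra.
have zd : z * tanh (beta * (z / N)) - z ^+ 2 / N - `|z| * E <= z * d.
  have : `|z * (d - (tanh (beta * (z / N)) - z / N))| <= `|z| * E.
    by rewrite normrM ler_wpM2l.
  move=> /ler_normlP[h1 h2].
  have -> : z ^+ 2 / N = z * (z / N) by ring.
  by lra.
have qq : flip_floor beta - c1 * (z ^+ 2 / N + 1) <= q * (1 - 8 * (z ^+ 2 + 1) / (K * N)).
  have h : q * (8 * (z ^+ 2 + 1) / (K * N)) <= c1 * (z ^+ 2 / N + 1).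
    apply: (@le_trans _ _ (4 * (8 * (z ^+ 2 + 1) / (K * N)))).
      rewrite ler_wpM2r// divr_ge0//; lra.
    have -> : 4 * (8 * (z ^+ 2 + 1) / (K * N)) = 32 / K * ((z ^+ 2 + 1) / N).
      by field; rewrite !lt0r_neq0.
    apply: ler_pM.
    - by rewrite divr_ge0// ltW.
    - by rewrite divr_ge0// ?ler0n//; lra.
    - by rewrite ler_pdivrMr.
    rewrite mulrDl lerD2l mul1r invf_le1//.
  lra.
have w2 : 0 <= z ^+ 2 / N by rewrite divr_ge0.
move: (z ^+ 2 / N) w2 drift err zd qq => x x0 drift err zd qq.
have : 2 * gamma * x >= 4 * c1 * x by rewrite ler_wpM2r.
lra.
Qed.

(** Below the threshold the drift of the squared sum of spins lowers the
    potential by a fraction of order [1 / n], and the truncation error is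
    controlled by [escape_balance]. *)
Lemma escape_potential_drift U s : (#|U| < k)%N ->
  fresh_update_mean beta U escape_potential s <=
   (1 - c1 / K / N) * escape_potential s + escape_leak / N ^+ 4.
Proof.
move=> Uk.
have [n1 n0 kn8 vv0] := And4 N1 N0 KN8 v0_gt0.
have kk8 := K8.
have kk1 : 1 <= K by lra.
have kk2 : 2 <= K by lra.
have U0 := card_fresh_gt0 Uk kn.
set z := signed_sum R (all_plus n) s.
have z2 := sqr_ge0 z.
pose kap := inv_sqr_potential N K z ^+ 2 / N ^+ 2.
pose g := z ^+ 2 / N + 1.
have g0 : 0 <= g by rewrite addr_ge0// divr_ge0.
have Q0 : 0 < z ^+ 2 + K * N by lra.
have kap0 : 0 <= kap by rewrite divr_ge0 ?sqr_ge0.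
have step v e : let D := spin R (all_plus n v) * (spin R e - spin R (s v)) in
   escape_excess (set_spin s v e) = escape_excess s +
   (inv_sqr_potential N K (z + D) - inv_sqr_potential N K z).
  by rewrite /= /escape_excess signed_sum_set_spin -/z; ring.
have Ng : z ^+ 2 + 1 <= N * g.
  by rewrite /g mulrDr mulr1 mulrCA mulfV ?lt0r_neq0// mulr1 lerD2l.
have cst0 : 0 <= escape_const.
  have p6 : 0 <= v0 ^+ 6 := exprn_ge0 _ (ltW v0_gt0).
  have pc : 0 <= c1 ^+ 2 := sqr_ge0 _.
  apply: mulr_ge0 p6; apply: addr_ge0.
    by apply: divr_ge0 pc; apply: exprn_ge0; rewrite mulr_ge0.
  by apply: divr_ge0 (ltW v0_gt0); rewrite mulr_ge0// mulr_ge0// exprn_ge0.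
have [w0|w0] := lerP 0 (escape_excess s); last first.
  (* above the threshold one update can only just reach back below it *)
  have -> : escape_potential s = 0.
    by rewrite /escape_potential max_l ?ltW// expr0n.
  rewrite mulr0 add0r.
  apply: (@le_trans _ _ ((256 * v0 ^+ 4) ^+ 2 / N ^+ 4)); last first.
    by rewrite ler_wpM2r ?invr_ge0 ?exprn_ge0// lerDr mulr_ge0// addr_ge0// ltW.
  have := @fresh_mean_quadratic R beta n U (all_plus n) s escape_potential
    ((256 * v0 ^+ 4) ^+ 2 / N ^+ 4) 0 0 U0.
  rewrite !mul0r !addr0; apply=> v e /=; rewrite !mul0r !addr0.
  have D4 := spin_increment_sqr R (all_plus n) s v e.
  have [_ h2] := inv_sqr_potential_step z N0 KN8 D4.
  rewrite /escape_potential step.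
  apply: le_trans (pos_part_quartic_neg _ (ltW w0)) _.
  set eta := _ - _ in h2 *; rewrite -/kap in h2.
  have kv : kap <= v0 ^+ 2 / N ^+ 2.
    rewrite ler_wpM2r ?invr_ge0 ?exprn_ge0// lerXn2r ?nnegrE ?divr_ge0 ?exprn_ge0 ?(ltW Q0) ?(ltW v0_gt0)//.
    by move: w0; rewrite subr_lt0; exact: ltW.
  have zN : z ^+ 2 + 1 <= 2 * N ^+ 2.
    have : z ^+ 2 <= N ^+ 2.
      rewrite -(real_normK (num_real z)) lerXn2r ?nnegrE//; exact: normr_signed_sum.
    have : 1 <= N ^+ 2 by rewrite exprn_ege1.
    by lra.
  have h3 : eta ^+ 2 <= 256 * v0 ^+ 4 / N ^+ 2.
    apply: le_trans h2 _.
    have -> : 256 * v0 ^+ 4 / N ^+ 2 = 128 * (v0 ^+ 2 / N ^+ 2) ^+ 2 * (2 * N ^+ 2).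
      by field; rewrite lt0r_neq0.
    apply: ler_pM => //; [|by rewrite addr_ge0|].
      by rewrite mulr_ge0// exprn_ge0.
    rewrite ler_pM2l//; apply: lerXn2r kv; rewrite nnegrE//.
    exact: divr_ge0 (sqr_ge0 _) (sqr_ge0 _).
  have -> : eta ^+ 4 = (eta ^+ 2) ^+ 2 by rewrite -exprM.
  have -> : (256 * v0 ^+ 4) ^+ 2 / N ^+ 4 = (256 * v0 ^+ 4 / N ^+ 2) ^+ 2.
    by field; rewrite lt0r_neq0.
  have e0 := le_trans (sqr_ge0 eta) h3.
  by apply: lerXn2r h3; rewrite nnegrE//; exact: sqr_ge0.
set w := escape_excess s in w0.
have wE : w + v0 = inv_sqr_potential N K z by rewrite /w /escape_excess subrK.
have potE : escape_potential s = w ^+ 4 by rewrite /escape_potential -/w max_r.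
pose cc := w ^+ 4 + 8 * 128 * w ^+ 2 * (kap ^+ 2 * (N * g))
    + 3 * 128 ^+ 2 * (kap ^+ 2 * (N * g)) ^+ 2.
apply: le_trans (@fresh_mean_quadratic R beta n U (all_plus n) s _
   cc (4 * w ^+ 3 * kap * (- 2 * z))
   (- (4 * w ^+ 3 * kap * (1 - 8 * (z ^+ 2 + 1) / (K * N)))) U0 _) _.
  move=> v e /=.
  have D4 := spin_increment_sqr R (all_plus n) s v e.
  have [h1 h2] := inv_sqr_potential_step z N0 KN8 D4.
  rewrite /escape_potential step -/w.
  move: h1 h2; rewrite -/kap.
  set D := spin R _ * _; set eta := _ - _; set x := 1 - _ / _ => h1 h2.
  apply: le_trans (pos_part_quartic _ _) _.
  have h3 : eta ^+ 2 <= 128 * (kap ^+ 2 * (N * g)).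
    apply: le_trans h2 _; rewrite mulrA ler_wpM2l// mulr_ge0// exprn_ge0//.
  have h4 : eta ^+ 4 <= 128 ^+ 2 * (kap ^+ 2 * (N * g)) ^+ 2.
    rewrite -exprMn; have -> : eta ^+ 4 = (eta ^+ 2) ^+ 2 by rewrite -exprM.
    by rewrite lerXn2r ?nnegrE ?sqr_ge0// (le_trans (sqr_ge0 _) h3).
  have H1 := ler_wpM2l (_ : 0 <= 4 * w ^+ 3) h1.
  have H2 := ler_wpM2l (_ : 0 <= 8 * w ^+ 2) h3.
  have {}H1 := H1 (mulr_ge0 (ler0n _ _) (exprn_ge0 _ w0)).
  have {}H2 := H2 (mulr_ge0 (ler0n _ _) (exprn_ge0 _ w0)).
  have H3 := ler_wpM2l (ler0n R 3) h4.
  rewrite /cc; move: (128 ^+ 2 * _) H3 => y H3.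
  lra.
have dt := escape_drift_term Uk w0.
rewrite -/z -/g in dt.
move: dt; set d := fresh_drift _ _ _ _; set q := fresh_square _ _ _; set x := 1 - _ / _ => dt.
have w3k : 0 <= 4 * w ^+ 3 * kap by rewrite mulr_ge0// mulr_ge0// exprn_ge0.
have := ler_wpM2l w3k dt => dt'.
apply: (@le_trans _ _ (w ^+ 4 - 8 * c1 * w ^+ 3 * (kap * g)
    + 8 * 128 * w ^+ 2 * (kap ^+ 2 * (N * g))
    + 3 * 128 ^+ 2 * (kap ^+ 2 * (N * g)) ^+ 2)).
  rewrite /cc; move: (3 * 128 ^+ 2 * _) (8 * 128 * _ * _) => y1 y2; lra.
have gE : g = (z ^+ 2 + N) / N by rewrite /g; field; rewrite lt0r_neq0.
have bal := @escape_balance R (8 * 128) (3 * 128 ^+ 2) N K v0 c1 w g kap.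
rewrite potE; apply: le_trans (bal _ _ N1 _ v0_gt0 c1_gt0 w0 g0 _ _ _ _ N_v0 Ka1 Ka2 N_const) _.
- by rewrite mulr_ge0.
- by rewrite mulr_ge0// exprn_ge0.
- exact: kk2.
- by rewrite wE /kap mulfVK// expf_neq0// lt0r_neq0.
- rewrite wE /inv_sqr_potential ler_pdivrMr//.
  have -> : N / K * (z ^+ 2 + K * N) = N ^+ 2 + N / K * z ^+ 2 by field; rewrite lt0r_neq0.
  by rewrite lerDl mulr_ge0// divr_ge0// ltW.
- rewrite wE /kap /inv_sqr_potential gE.
  have -> : (N ^+ 2 / (z ^+ 2 + K * N)) ^+ 2 / N ^+ 2 * ((z ^+ 2 + N) / N) =
     N ^+ 2 / (z ^+ 2 + K * N) / N * ((z ^+ 2 + N) / (z ^+ 2 + K * N)).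
    by field; rewrite !lt0r_neq0.
  have Y0 : 0 <= N ^+ 2 / (z ^+ 2 + K * N) / N.
    by rewrite divr_ge0// divr_ge0 ?exprn_ge0// ltW.
  rewrite (ler_piMr Y0)//.
  by rewrite ler_pdivrMr// mul1r lerD2l -[leLHS]mul1r ler_wpM2r.
- rewrite wE /kap /inv_sqr_potential gE.
  have -> : (N ^+ 2 / (z ^+ 2 + K * N)) ^+ 2 / N ^+ 2 * ((z ^+ 2 + N) / N) =
     N ^+ 2 / (z ^+ 2 + K * N) / (K * N) * ((K * (z ^+ 2 + N)) / (z ^+ 2 + K * N)).
    by field; rewrite !lt0r_neq0.
  have Y0 : 0 <= N ^+ 2 / (z ^+ 2 + K * N) / (K * N).
    exact: divr_ge0 (divr_ge0 (exprn_ge0 _ (ltW N0)) (ltW Q0)) (ltW (mulr_gt0 K0 N0)).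
  rewrite (ler_peMr Y0)//.
  by rewrite ler_pdivlMr// mul1r mulrDr lerD2r -[leLHS]mul1r ler_wpM2r.
rewrite -/escape_const lerD2l ler_wpM2r ?invr_ge0 ?exprn_ge0//.
by rewrite /escape_leak lerDl sqr_ge0.
Qed.

End EscapeDrift.

(** * Contraction of the combined cost *)

Section TwoPhaseCoupling.
Variables (R : realType) (beta : R) (n k : nat) (s0 L cV c vb leak : R).
Variable V : config n -> R.
Implicit Types (s t : config n) (U : {set 'I_n}).
Local Notation N := (n%:R : R).
Local Notation P := (@restricted_rss R beta n k).
Local Notation scan_mean F s := (fresh_scan_mean beta k finset.set0 F s).

Hypotheses (k_gt0 : (0 < k)%N) (k_lt_n : (k < n)%N).
Hypothesis s0_gt0 : 0 < s0.
Hypothesis L01 : 0 < L < 1.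
Hypothesis tanh_contracts : forall x y, s0 <= x -> s0 <= y ->
  `|tanh (beta * x) - tanh (beta * y)| <= L * `|x - y|.
Hypothesis k_small : 4 * k%:R <= contraction_rate L * N.
Hypotheses (V_ge0 : forall s, 0 <= V s) (V_le : forall s, V s <= N ^+ 4).
Hypothesis V_fold : forall s, V (fold_plus R s) = V s.
Hypothesis V_drift : forall U s, (#|U| < k)%N ->
  fresh_update_mean beta U V s <= (1 - cV / N) * V s + leak / N ^+ 4.
Hypothesis V_low : forall s, 0 <= magnetization R s ->
  magnetization R s < s0 + (2 * k + 1)%:R / N -> vb <= V s.
Hypotheses (cV_gt0 : 0 < cV) (cV_small : cV * k%:R <= N) (leak_ge0 : 0 <= leak).
Hypotheses (c_gt0 : 0 < c) (c_rate : c <= contraction_rate L) (c_cV : 4 * c <= cV)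
  (vb_gt0 : 0 < vb).

(** The weight of the potentials.  A pair of which one copy has small
    magnetization can gain up to [n] in Hamming distance in one scan, when it is
    folded; the potential of that copy is then at least [vb] and loses a
    fraction of order [c * k / n] of itself. *)
Definition balance : R := N ^+ 2 / (c * vb).
Definition coupling_cost s t : R := hamming R s t + balance * (V s + V t).
Definition decay : R := 1 - c * (k%:R / N).

Let n_gt0 : (0 < n)%N. Proof. by move: k_lt_n; case: (n). Qed.
Let N0 : 0 < N. Proof. by rewrite ltr0n. Qed.
Let k1 : 1 <= k%:R :> R. Proof. by rewrite ler1n. Qed.
Let kn : (k <= n)%N. Proof. exact: ltnW. Qed.
Let M0 : 0 < balance. Proof. by rewrite divr_gt0 ?exprn_gt0// mulr_gt0. Qed.

Lemma hamming_ge0 s t : 0 <= hamming R s t.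
Proof. by rewrite sumr_ge0// => v _; exact: differ_ge0. Qed.

Lemma hamming_le s t : hamming R s t <= N.
Proof.
rewrite -[leRHS](_ : \sum_(v : 'I_n) 1 = _); last by rewrite sumr_const card_ord.
by apply: ler_sum => v _; rewrite /differ; case: (_ != _).
Qed.

Lemma hamming_neq_ge1 s t : s != t -> 1 <= hamming R s t.
Proof.
move=> st; have [v vst] : exists v, s v != t v.
  apply/existsP; apply: contraNT st; rewrite negb_exists => /forallP h.
  by apply/eqP/ffunP => v; apply/eqP; have := h v; rewrite negbK.
rewrite /hamming (bigD1 v)//= /differ vst lerDl sumr_ge0//.
Qed.

Lemma one_sub_expr_le (y : R) j : 0 <= y <= 1 -> j%:R * y <= 1 ->
  (1 - y) ^+ j <= 1 - j%:R * y / 2.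
Proof.
move=> /andP[y0 y1]; elim: j => [|j IH] h; first by rewrite !mul0r subr0.
have jy : j%:R * y <= 1.
  by apply: le_trans h; rewrite ler_wpM2r// ler_nat.
have := ler_wpM2r (_ : 0 <= 1 - y) (IH jy); rewrite subr_ge0 => /(_ y1) H.
rewrite exprSr; apply: (le_trans H); rewrite -[j.+1%:R]natr1.
have : y * (j%:R * y) <= y by rewrite ler_piMr.
by lra.
Qed.

(** The factor 2 in the rate leaves half of the decay of the potential to pay for
    the Hamming distance. *)
Lemma V_scan s : scan_mean V s <= (1 - 2 * c * (k%:R / N)) * V s + k%:R * (leak / N ^+ 4).
Proof.
have cVk : cV / N * k%:R <= 1 by rewrite mulrAC ler_pdivrMr// mul1r.
have y0 : 0 <= cV / N by rewrite divr_ge0// ltW.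
have y1 : cV / N <= 1 by apply: le_trans cVk; rewrite ler_peMr.
have r0 : 0 <= 1 - cV / N by rewrite subr_ge0.
apply: le_trans (@scan_drift _ _ _ _ kn _ (leak / N ^+ 4) V s r0 V_drift) _.
apply: lerD.
  rewrite ler_wpM2r//.
  apply: (@le_trans _ _ (1 - k%:R * (cV / N) / 2)).
    by apply: one_sub_expr_le; rewrite ?y0 ?y1// mulrC.
  have : 0 <= (cV - 4 * c) * (k%:R / N).
    by rewrite mulr_ge0 ?divr_ge0// subr_ge0.
  have -> : k%:R * (cV / N) / 2 = cV * (k%:R / N) / 2 by ring.
  by lra.
rewrite mulrC ler_wpM2r ?divr_ge0 ?exprn_ge0//.
rewrite -[leRHS](_ : \sum_(i < k) 1 = _); last by rewrite sumr_const card_ord.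
apply: ler_sum => i _; rewrite exprn_ile1//.
by rewrite gerBl.
Qed.

Lemma update_meanD v (F G : config n -> R) s :
  update_mean beta v (fun t => F t + G t) s =
  update_mean beta v F s + update_mean beta v G s.
Proof. by rewrite /update_mean; ring. Qed.

Lemma fresh_scan_meanD j U (F G : config n -> R) s :
  fresh_scan_mean beta j U (fun t => F t + G t) s =
  fresh_scan_mean beta j U F s + fresh_scan_mean beta j U G s.
Proof.
elim: j U s => [//|j IH] U s /=.
rewrite -mulrDl -big_split/=; congr (_ / _); apply: eq_bigr => v _.
by rewrite -update_meanD /update_mean !IH.
Qed.

Lemma scan_mean_affine a b (F : config n -> R) s :
  scan_mean (fun t => a * F t + b) s = a * scan_mean F s + b.
Proof. by rewrite fresh_scan_mean_affine// card_setC_set0. Qed.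

(** Two independent copies suffice when no contraction of the distance is
    needed. *)
Lemma scan_mean_sub_le (F W : config n -> R) B s t :
  (forall s t, F s - F t <= B + W s + W t) ->
  scan_mean F s - scan_mean F t <= B + scan_mean W s + scan_mean W t.
Proof.
move=> H.
have H1 u : scan_mean F s <= scan_mean W s + (F u + B + W u).
  rewrite -[scan_mean W s]mul1r -scan_mean_affine.
  by apply: fresh_scan_mean_le => w; have := H w u; lra.
have : scan_mean F s - scan_mean W s - B <= scan_mean F t + scan_mean W t.
  rewrite -fresh_scan_meanD -[leLHS](scan_mean_cst beta kn _ t).
  by apply: fresh_scan_mean_le => u; have := H1 u; lra.
by lra.
Qed.

(** Being bounded by a multiple of the cost, up to a constant, is preserved by one
    step with a smaller multiple.  If both copies have magnetization above [s0]
    with a margin, no folding occurs and [fresh_scan_contracts] applies; otherwise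
    the decay of the potential pays for everything. *)
Lemma one_step_contraction (f : omega_plus R n -> R) (C E : R) : 0 <= C ->
  (forall x y, f x - f y <= C * coupling_cost (val x) (val y) + E) ->
  forall x y, expect P f x - expect P f y <=
    C * decay * coupling_cost (val x) (val y) +
    (E + C * (2 * balance * (k%:R * (leak / N ^+ 4)))).
Proof.
move=> C0 H x y; rewrite !(expect_restricted_fold _ kn).
have mx := valP x; have my := valP y; move: mx my.
move: (val x) (val y) => s t ms mt.
pose F := f \o @fold_omega R n.
pose W s := C * balance * V s + E / 2.
have WE u : scan_mean W u <=
    C * balance * ((1 - 2 * c * (k%:R / N)) * V u + k%:R * (leak / N ^+ 4)) + E / 2.
  rewrite scan_mean_affine lerD2r ler_wpM2l//; first by rewrite mulr_ge0// ltW.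
  exact: V_scan.
have Ws := WE s; have Wt := WE t.
have r0 : 0 <= k%:R / N by rewrite divr_ge0.
have r0' : 0 < k%:R / N by rewrite divr_gt0// ltr0n.
have cr := c_rate. have M0' := M0.
have badcase : vb <= V s + V t ->
    scan_mean F s - scan_mean F t <= C * decay * coupling_cost s t +
      (E + C * (2 * balance * (k%:R * (leak / N ^+ 4)))).
  move=> low.
  have FW u w : F u - F w <= C * N + W u + W w.
    apply: le_trans (H _ _) _; rewrite /= /coupling_cost !V_fold /W.
    have := ler_wpM2l C0 (hamming_le (fold_plus R u) (fold_plus R w)).
    by lra.
  apply: le_trans (scan_mean_sub_le _ _ FW) _.
  have d0 : 0 <= decay.
    rewrite /decay subr_ge0 mulrA ler_pdivrMr// mul1r.
    have : 4 * c * k%:R <= cV * k%:R by rewrite ler_wpM2r.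
    have : 0 <= c * k%:R by rewrite mulr_ge0// ltW.
    by have := cV_small; lra.
  have comp : N <= balance * (c * (k%:R / N)) * (V s + V t).
    have -> : balance * (c * (k%:R / N)) * (V s + V t) = N * (k%:R * ((V s + V t) / vb)).
      by rewrite /balance; field; rewrite !lt0r_neq0.
    rewrite (ler_peMr (ltW N0))//.
    have : 1 <= (V s + V t) / vb by rewrite ler_pdivlMr// mul1r.
    by move=> h; have := ler_wpM2l (ler0n R k) h; have := k1; lra.
  have h1 := ler_wpM2l C0 comp.
  have h2 : 0 <= C * (decay * hamming R s t) by rewrite mulr_ge0// mulr_ge0// hamming_ge0.
  rewrite /coupling_cost; move: Ws Wt h1 h2; rewrite /decay; lra.
have [hs|hs] := lerP (s0 + (2 * k + 1)%:R / N) (magnetization R s); last first.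
  by apply: badcase; apply: le_trans (V_low ms hs) _; rewrite lerDl.
have [ht|ht] := lerP (s0 + (2 * k + 1)%:R / N) (magnetization R t); last first.
  by apply: badcase; apply: le_trans (V_low mt ht) _; rewrite lerDr.
have Fid u : s0 <= magnetization R u -> fold_plus R u = u.
  by move=> h; rewrite /fold_plus ifT// (le_trans (ltW s0_gt0)).
have FW u w : s0 <= magnetization R u -> s0 <= magnetization R w ->
    F u - F w <= C * hamming R u w + W u + W w.
  move=> hu hw; apply: le_trans (H _ _) _; rewrite /= !Fid//.
  by rewrite /coupling_cost /W; lra.
have := @fresh_scan_contracts R beta n k s0 L n_gt0 L01 tanh_contracts k_small
   C F W k finset.set0 s t C0 _ k_lt_n FW hs ht.
rewrite cards0 addn0 leqnn => /(_ isT)/le_trans; apply.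
have -> : stale_hamming R finset.set0 s t = 0.
  by rewrite /stale_hamming big1// => v; rewrite inE.
have -> : fresh_hamming R finset.set0 s t = hamming R s t.
  by rewrite /fresh_hamming; apply: eq_bigl => v; rewrite inE.
have h1 : C * (fresh_weight n L k * hamming R s t) <= C * (decay * hamming R s t).
  rewrite ler_wpM2l// ler_wpM2r ?hamming_ge0// /fresh_weight /decay.
  by rewrite lerD2l lerN2 ler_wpM2r.
have h2 : 0 <= C * balance * (c * (k%:R / N)) * (V s + V t).
  by rewrite mulr_ge0 ?addr_ge0// mulr_ge0 ?(mulr_ge0 C0 (ltW M0))// mulr_ge0// ltW.
rewrite mulr0 addr0 /coupling_cost.
move: Ws Wt h1 h2; rewrite /decay; lra.
Qed.


Let decay_ge0 : 0 <= decay.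
Proof.
rewrite /decay subr_ge0 mulrA ler_pdivrMr// mul1r.
have : 4 * c * k%:R <= cV * k%:R by rewrite ler_wpM2r.
have : 0 <= c * k%:R by rewrite mulr_ge0// ltW.
by have := cV_small; lra.
Qed.

Lemma many_steps_contraction (f : omega_plus R n -> R) m :
  (forall x y, f x - f y <= (x != y)%:R) ->
  forall x y, expect (step_pow P m) f x - expect (step_pow P m) f y <=
    decay ^+ m * coupling_cost (val x) (val y) +
    2 * leak / (c ^+ 2 * vb * N) * (1 - decay ^+ m).
Proof.
move=> f1; elim: m => [|m IH] x y.
  rewrite !expect_step_id !expr0 subrr mulr0 addr0 mul1r.
  apply: le_trans (f1 x y) _.
  have cost0 : 0 <= balance * (V (val x) + V (val y)).
    by rewrite mulr_ge0 ?addr_ge0// ltW.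
  case: (eqVneq x y) => [->|xy] /=.
    by apply: addr_ge0; [exact: hamming_ge0|rewrite mulr_ge0 ?addr_ge0// ltW].
  rewrite /coupling_cost; have : val x != val y by rewrite (inj_eq val_inj).
  by move=> /hamming_neq_ge1; lra.
rewrite !expect_step_powS.
apply: le_trans (one_step_contraction (exprn_ge0 m decay_ge0) IH x y) _.
rewrite -exprSr le_eqVlt; apply/orP; left; apply/eqP; congr (_ + _).
have -> : decay ^+ m.+1 = decay ^+ m * (1 - c * (k%:R / N)) by rewrite exprSr.
rewrite /balance; move: (decay ^+ m) => d; field.
by rewrite !lt0r_neq0.
Qed.

Lemma worst_dist_upper mu m : stationary_distribution P mu ->
  worst_dist P mu m <=
    decay ^+ m * (N + 2 * balance * N ^+ 4) + 2 * leak / (c ^+ 2 * vb * N).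
Proof.
move=> st.
have d0 : 0 <= decay ^+ m by rewrite exprn_ge0.
have b0 : 0 <= N + 2 * balance * N ^+ 4.
  by rewrite addr_ge0// mulr_ge0 ?exprn_ge0// mulr_ge0// ltW.
have l0 : 0 <= 2 * leak / (c ^+ 2 * vb * N).
  by rewrite divr_ge0 ?mulr_ge0 ?exprn_ge0// ltW.
apply: worst_dist_le st _.
  by rewrite addr_ge0// mulr_ge0.
move=> f x y f1; apply: le_trans (many_steps_contraction m f1 x y) _.
apply: lerD; last by rewrite ler_piMr// gerBl.
rewrite ler_wpM2l// /coupling_cost lerD ?hamming_le//.
have -> : 2 * balance * N ^+ 4 = balance * (2 * N ^+ 4) by ring.
rewrite (ler_wpM2l (ltW M0))//.
have := V_le (val x); have := V_le (val y); lra.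
Qed.

End TwoPhaseCoupling.

(** * Upper bound for large systems *)

Section EscapePotential.
Variables (R : realType) (n : nat) (s1 K : R).
Implicit Types s : config n.
Local Notation N := (n%:R : R).
Hypotheses (n_gt0 : (0 < n)%N) (K1 : 1 <= K) (s1_gt0 : 0 < s1).

Lemma escape_potential_ge0 s : 0 <= escape_potential s1 K s.
Proof. by rewrite exprn_ge0// le_max lexx. Qed.

Lemma escape_potential_fold s :
  escape_potential s1 K (fold_plus R s) = escape_potential s1 K s.
Proof.
rewrite /fold_plus; case: ifP => // _.
by rewrite /escape_potential /escape_excess /inv_sqr_potential signed_sum_flip sqrrN.
Qed.

Let N0 : 0 < N. Proof. by rewrite ltr0n. Qed.

Lemma escape_potential_le s : escape_potential s1 K s <= N ^+ 4.
Proof.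
rewrite /escape_potential; apply: lerXn2r.
- by rewrite nnegrE le_max lexx.
- by rewrite nnegrE ltW.
rewrite ge_max ltW//= /escape_excess /inv_sqr_potential lerBlDr.
have v0 : 0 < threshold s1 by rewrite invr_gt0 exprn_gt0.
have K1' := K1; have N0' := N0.
set z := signed_sum _ _ _; have z2 := sqr_ge0 z.
have KN : N <= K * N by rewrite ler_peMl// ltW.
rewrite ler_pdivrMr; last lra.
have : 0 <= (N + threshold s1) * z ^+ 2 by rewrite mulr_ge0//; lra.
have : 0 <= threshold s1 * (K * N) by rewrite mulr_ge0//; lra.
have : N * N <= N * (K * N) by rewrite ler_wpM2l// ltW.
rewrite !mulrDl !mulrDr -expr2; lra.
Qed.

Lemma escape_potential_low (s2 d : R) s : 0 <= s2 -> 0 < d -> K <= d * N ->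
  s2 ^+ 2 + d < s1 ^+ 2 ->
  0 <= magnetization R s -> magnetization R s < s2 ->
  ((s2 ^+ 2 + d)^-1 - threshold s1) ^+ 4 <= escape_potential s1 K s.
Proof.
move=> s20 d0 Kd ds m0 m2; have N0' := N0; have K1' := K1.
have p0 : 0 < s2 ^+ 2 + d by rewrite ltr_wpDl ?exprn_ge0.
apply: lerXn2r.
- by rewrite nnegrE subr_ge0 lef_pV2 ?posrE ?exprn_gt0// ltW.
- by rewrite nnegrE le_max lexx.
rewrite le_max; apply/orP; right.
rewrite /escape_excess lerD2r /inv_sqr_potential.
have zE : signed_sum R (all_plus n) s = magnetization R s * N.
  by rewrite magnetizationE divfK// lt0r_neq0.
rewrite zE; set x := magnetization R s in m0 m2 *.
have x2 : x ^+ 2 <= s2 ^+ 2 by rewrite lerXn2r ?nnegrE// ltW.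
have KN : 0 < K * N by rewrite mulr_gt0//; lra.
have Q0 : 0 < (x * N) ^+ 2 + K * N by rewrite ltr_wpDl ?sqr_ge0.
rewrite -[leLHS]mul1r ler_pdivrMr// mulrAC ler_pdivlMr// mul1r.
have -> : N ^+ 2 * (s2 ^+ 2 + d) = s2 ^+ 2 * N ^+ 2 + (d * N) * N by ring.
have h1 : x ^+ 2 * N ^+ 2 <= s2 ^+ 2 * N ^+ 2 by rewrite ler_wpM2r// exprn_ge0// ltW.
have h2 : K * N <= d * N * N by rewrite ler_wpM2r// ltW.
rewrite exprMn; lra.
Qed.

End EscapePotential.

Lemma ratio_small (R : realType) (a x y : R) : 0 < a -> 0 <= x -> 1 <= y ->
  x ^+ 2 <= y -> (a ^+ 2)^-1 <= y -> x <= a * y.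
Proof.
move=> a0 x0 y1 xy ay.
have h : 1 <= a ^+ 2 * y by move: ay; rewrite -div1r ler_pdivrMr ?exprn_gt0// mulrC.
have h2 : y <= (a * y) ^+ 2.
  rewrite (_ : (a * y) ^+ 2 = (a ^+ 2 * y) * y); last by ring.
  by rewrite ler_peMl//; lra.
rewrite -(@ler_pXn2r _ 2)// ?nnegrE//; first exact: le_trans xy h2.
by rewrite mulr_ge0//; lra.
Qed.

(** The initial cost is at most [A * n ^+ 6], and [m] steps bring it down by the
    factor [n ^- 7]. *)
Lemma cost_after_nlogn (R : realType) (n k m : nat) (c vb leak : R) :
  let A := 1 + 2 / (c * vb) in
  0 < c -> 0 < vb -> 1 <= n%:R :> R -> 0 <= decay n k c ->
  8 * A <= n%:R -> 16 * leak / (c ^+ 2 * vb) <= n%:R ->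
  7 / c * (n%:R * ln n%:R) <= m%:R * k%:R ->
  decay n k c ^+ m * (n%:R + 2 * balance n c vb * n%:R ^+ 4)
    + 2 * leak / (c ^+ 2 * vb * n%:R) <= 1 / 4.
Proof.
move=> A c0 vb0 n1 dec0 hA hl mk.
have nR : 0 < n%:R :> R := lt_le_trans ltr01 n1.
have part2 : 2 * leak / (c ^+ 2 * vb * n%:R) <= 1 / 8.
  have cv0 : 0 < c ^+ 2 * vb by rewrite mulr_gt0// exprn_gt0.
  have -> : 2 * leak / (c ^+ 2 * vb * n%:R) = (16 * leak / (c ^+ 2 * vb)) / n%:R / 8.
    by field; rewrite !lt0r_neq0.
  by rewrite ler_wpM2r// ler_pdivrMr// mul1r.
have dec : decay n k c ^+ m <= (n%:R ^+ 7)^-1.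
  apply: (@le_trans _ _ (expR (- (c * (k%:R / n%:R))) ^+ m)).
    rewrite lerXn2r ?nnegrE ?expR_ge0//; exact: expR_ge1Dx.
  have -> : (n%:R ^+ 7)^-1 = expR (- (7%:R * ln n%:R)) :> R.
    by rewrite expRN expRM_natl lnK// posrE.
  rewrite -expRM_natl ler_expR mulrN lerN2.
  have -> : m%:R * (c * (k%:R / n%:R)) = m%:R * k%:R * (c / n%:R) by ring.
  rewrite -ler_pdivrMr ?divr_gt0//; apply: le_trans mk.
  by rewrite le_eqVlt; apply/orP; left; apply/eqP; field; rewrite !lt0r_neq0.
have sz : n%:R + 2 * balance n c vb * n%:R ^+ 4 <= A * n%:R ^+ 6.
  have -> : A * n%:R ^+ 6 = n%:R ^+ 6 + 2 * balance n c vb * n%:R ^+ 4.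
    by rewrite /A /balance; field; rewrite !lt0r_neq0.
  by rewrite lerD2r -[leLHS]expr1 ler_weXn2l.
have part1 : decay n k c ^+ m * (n%:R + 2 * balance n c vb * n%:R ^+ 4) <= 1 / 8.
  apply: (@le_trans _ _ ((n%:R ^+ 7)^-1 * (A * n%:R ^+ 6))).
    apply: ler_pM => //; first by rewrite exprn_ge0.
    rewrite addr_ge0// mulr_ge0 ?exprn_ge0// mulr_ge0// divr_ge0 ?exprn_ge0// ltW//.
    by rewrite mulr_gt0.
  have -> : (n%:R ^+ 7)^-1 * (A * n%:R ^+ 6) = A / n%:R :> R by field; rewrite lt0r_neq0.
  by rewrite ler_pdivrMr//; move: hA; clear; lra.
by move: part1 part2; clear; lra.
Qed.

(** The constants are chosen in the order [c1], [K], [cV], [c], then [n] large: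
    the threshold for [n] is the sum of the finitely many lower bounds listed in
    [thr]. *)
Lemma worst_dist_after_nlogn (R : realType) (beta : R) : 1 < beta ->
  exists C eps : R, exists N0 : nat, [/\ 0 < C, 0 < eps &
  forall (n k m : nat) (mu : omega_plus R n -> R), (N0 <= n)%N -> (0 < k)%N ->
    k%:R ^+ 2 <= eps * n%:R ->
    stationary_distribution (@restricted_rss R beta n k) mu ->
    C * (n%:R * ln n%:R) <= m%:R * k%:R ->
    worst_dist (@restricted_rss R beta n k) mu m <= 1 / 4].
Proof.
move=> b1; have b0 : 0 < beta by lra.
have [s0 [s1 [gamma [L [[s00 s01 g0 L0 L1] [repel contract]]]]]] :=
  escape_and_contraction_window b1.
have s10 : 0 < s1 by lra.
have phi0 := flip_floor_gt0 beta.
pose c1 := Num.min (2 * gamma) (flip_floor beta) / 4.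
have c10 : 0 < c1 by rewrite divr_gt0// lt_min phi0 mulr_gt0.
have c1g : 4 * c1 <= 2 * gamma by rewrite /c1 mulrC divfK// ge_min lexx.
have c1f : 4 * c1 <= flip_floor beta by rewrite /c1 mulrC divfK// ge_min lexx orbT.
pose v0 := threshold s1.
have v00 : 0 < v0 by rewrite invr_gt0 exprn_gt0.
pose b : R := 8 * (3 * 128 ^+ 2).
have b_ge0 : 0 <= b by rewrite mulr_ge0// mulr_ge0// exprn_ge0.
pose a : R := 2 * (8 * 128).
have a_ge0 : 0 <= a by rewrite mulr_ge0// mulr_ge0.
have bv : 0 <= b / v0 by rewrite divr_ge0// ltW.
pose K := 8 + (32 + a + b / v0) / c1.
have K8 : 8 <= K by rewrite lerDl divr_ge0 ?(ltW c10)// !addr_ge0.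
have cK : c1 * K = 8 * c1 + (32 + a + b / v0).
  by rewrite /K mulrDr [c1 * (_ / c1)]mulrC divfK ?lt0r_neq0// [c1 * 8]mulrC.
have K32 : 32 <= c1 * K by rewrite cK; lra.
have K1 : 1 <= K by lra.
have Ka : a <= c1 * K by rewrite cK; lra.
have Kb : b <= v0 * c1 * K.
  rewrite -mulrA cK -ler_pdivrMl// mulrC; lra.
pose s2 := (s0 + s1) / 2; pose d := (s1 ^+ 2 - s2 ^+ 2) / 2.
have s2b : s0 < s2 < s1 by rewrite /s2; lra.
have s2s : s2 ^+ 2 < s1 ^+ 2 by rewrite ltrXn2r// ?nnegrE; lra.
have s20 : 0 <= s2 by lra.
have d0 : 0 < d by rewrite /d; lra.
have ds : s2 ^+ 2 + d < s1 ^+ 2 by rewrite /d; lra.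
pose vb := ((s2 ^+ 2 + d)^-1 - v0) ^+ 4.
have p0 : 0 < s2 ^+ 2 + d by rewrite ltr_wpDl ?sqr_ge0.
have vb0 : 0 < vb by rewrite exprn_gt0// subr_gt0 ltf_pV2 ?posrE ?exprn_gt0.
pose cV := c1 / K.
have cV0 : 0 < cV by rewrite divr_gt0//; lra.
pose c := Num.min (contraction_rate L) (cV / 4).
have cL0 : 0 < contraction_rate L by rewrite /contraction_rate; lra.
have c0 : 0 < c by rewrite lt_min cL0 divr_gt0.
have ccL : c <= contraction_rate L by rewrite ge_min lexx.
have ccV : 4 * c <= cV by rewrite mulrC -ler_pdivlMr// ge_min lexx orbT.
pose leak := escape_leak s1 c1.
have leak0 : 0 <= leak.
  apply: addr_ge0; last exact: sqr_ge0.
  apply: mulr_ge0; last by rewrite addr_ge0// ltW.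
  have pc : 0 <= c1 ^+ 2 := sqr_ge0 _.
  apply: mulr_ge0; last by rewrite exprn_ge0// ltW.
  apply: addr_ge0.
    by apply: divr_ge0 pc; apply: exprn_ge0; rewrite mulr_ge0.
  by apply: divr_ge0 (ltW v00); rewrite mulr_ge0// mulr_ge0// exprn_ge0.
pose eps := Num.min 1 (c1 ^+ 2 / (beta + 4) ^+ 2).
have b4 : 0 < (beta + 4) ^+ 2 by rewrite exprn_gt0//; lra.
have eps0 : 0 < eps by rewrite lt_min ltr01 divr_gt0// exprn_gt0.
pose A := 1 + 2 / (c * vb).
have A0 : 0 <= A by rewrite addr_ge0// divr_ge0// ltW// mulr_gt0.
pose r := Num.min (1 / 4) (Num.min ((s2 - s0) / 3) (Num.min (contraction_rate L / 4) cV^-1)).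
have r0 : 0 < r.
  by rewrite !lt_min invr_gt0 cV0 !divr_gt0// subr_gt0; case/andP: s2b.
pose thr : seq R := [:: K * v0; escape_const s1 c1 * K / c1; K / d; (r ^+ 2)^-1;
   8 * A; 16 * leak / (c ^+ 2 * vb); 1].
exists (7 / c), eps, (Num.bound (\sum_(x <- thr) `|x|)); split => //.
  by rewrite divr_gt0.
move=> n k m mu Nn k0 keps st mk.
have large x : x \in thr -> x <= n%:R.
  move=> xt; apply: le_trans (ler_norm _) _.
  apply: (@le_trans _ _ (\sum_(x <- thr) `|x|)).
    by rewrite (big_rem _ xt)/= lerDl sumr_ge0.
  have s_ge0 : 0 <= \sum_(x <- thr) `|x| by rewrite sumr_ge0.
  by apply: le_trans (ltW (archi_boundP s_ge0)) _; rewrite ler_nat.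
have n1 : 1 <= n%:R :> R by apply: large; rewrite !inE eqxx !orbT.
have n0 : (0 < n)%N by rewrite -(ler1n R).
have nR : 0 < n%:R :> R by rewrite ltr0n.
have hv : K * v0 <= n%:R by apply: large; rewrite !inE eqxx.
have hc : escape_const s1 c1 * K <= c1 * n%:R.
  by rewrite mulrC [c1 * _]mulrC -ler_pdivrMr// mulrC; apply: large; rewrite !inE eqxx !orbT.
have hd : K <= d * n%:R.
  by rewrite [d * _]mulrC -ler_pdivrMr//; apply: large; rewrite !inE eqxx !orbT.
have hA : 8 * A <= n%:R by apply: large; rewrite !inE eqxx !orbT.
have hl : 16 * leak / (c ^+ 2 * vb) <= n%:R by apply: large; rewrite !inE eqxx !orbT.
have hr : (r ^+ 2)^-1 <= n%:R by apply: large; rewrite !inE eqxx !orbT.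
have kk : k%:R ^+ 2 <= n%:R :> R.
  by apply: le_trans keps _; rewrite (ler_piMl (ltW nR))// ge_min lexx.
have kr : k%:R <= r * n%:R by apply: ratio_small.
have k1 : 1 <= k%:R :> R by rewrite ler1n.
have [r1 r2 r3 r4] : [/\ r <= 1 / 4, r <= (s2 - s0) / 3, r <= contraction_rate L / 4 & r <= cV^-1].
  by rewrite /r; split; rewrite !ge_min lexx ?orbT.
have bnd x : r <= x -> k%:R <= x * n%:R.
  by move=> rx; apply: le_trans kr _; rewrite ler_wpM2r// ltW.
have k4 := bnd _ r1.
have k2n : (2 * k <= n)%N by rewrite -(ler_nat R) natrM; move: k4 nR; clear; lra.
have kltn : (k < n)%N by rewrite -(ltr_nat R); move: k4 nR; clear; lra.
have k3 := bnd _ r2; have kL := bnd _ r3; have kV := bnd _ r4.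
have kV' : cV * k%:R <= n%:R by move: kV; rewrite ler_pdivlMl.
have L01 : 0 < L < 1 by rewrite L0.
have k_small : 4 * k%:R <= contraction_rate L * n%:R.
  by move: kL; clear; lra.
have err : n%:R * ((beta + 4) * (k%:R / n%:R)) ^+ 2 <= c1 ^+ 2.
  have -> : n%:R * ((beta + 4) * (k%:R / n%:R)) ^+ 2 = (beta + 4) ^+ 2 * (k%:R ^+ 2 / n%:R).
    by field; rewrite lt0r_neq0.
  rewrite mulrC -ler_pdivlMr// ler_pdivrMr//; apply: le_trans keps _.
  by rewrite ler_wpM2r ?ler0n// ge_min lexx orbT.
have low s : 0 <= magnetization R s ->
    magnetization R s < s0 + (2 * k + 1)%:R / n%:R -> vb <= @escape_potential R n s1 K s.
  move=> m0 ml; apply: escape_potential_low => //.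
  apply: (lt_le_trans ml); rewrite -lerBrDl ler_pdivrMr// natrD natrM.
  by move: k3 k1; clear; lra.
have drift := @escape_potential_drift R beta n k s1 gamma c1 K b0 k0 k2n s10 repel
  c10 c1g c1f err K8 K32 Ka Kb hv hc.
have := @worst_dist_upper R beta n k s0 L cV c vb leak (@escape_potential R n s1 K)
  k0 kltn s00 L01 contract k_small (@escape_potential_ge0 R n s1 K)
  (escape_potential_le n0 K1 s10) (@escape_potential_fold R n s1 K) drift low
  cV0 kV' leak0 c0 ccL ccV vb0 mu m st.
move=> /le_trans; apply.
apply: cost_after_nlogn => //.
rewrite /decay subr_ge0 mulrA ler_pdivrMr// mul1r.
have : 4 * c * k%:R <= cV * k%:R by rewrite ler_wpM2r.
have : 0 <= c * k%:R by rewrite mulr_ge0// ltW.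
by move: kV'; clear; lra.
Qed.

(** * Mixing of a fixed system *)

Section FixedSize.
Variables (R : realType) (beta : R) (n k : nat).
Hypotheses (beta_gt0 : 0 < beta) (k_gt0 : (0 < k)%N) (kn : (k <= n)%N).
Implicit Types (s t : config n) (U : {set 'I_n}).
Local Notation P := (@restricted_rss R beta n k).

Let n_gt0 : (0 < n)%N. Proof. exact: leq_trans kn. Qed.

Definition plus_floor : R := flip_floor beta / 4 / n%:R.

Lemma plus_floor_gt0 : 0 < plus_floor.
Proof. by rewrite !divr_gt0 ?ltr0n// flip_floor_gt0. Qed.

Lemma flip_floor_plus_prob s v : flip_floor beta / 4 <= plus_prob beta s v.
Proof.
rewrite plus_probE /flip_floor /local_tanh.
have := normr_local_arg R s v n_gt0; move: (_ - _ / _) => y /ler_normlP[y1 y2].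
have : - tanh (2 * beta) <= tanh (beta * y).
  rewrite -tanhN; apply: ler_tanh.
  have : 0 <= beta * (2 + y) by rewrite mulr_ge0 ?(ltW beta_gt0)//; lra.
  lra.
lra.
Qed.

Definition below s t := forall v, s v -> t v.

Lemma update_mean_ge0 v (h : config n -> R) s : (forall t, 0 <= h t) ->
  0 <= update_mean beta v h s.
Proof.
move=> h0; rewrite /update_mean addr_ge0// mulr_ge0// ?subr_ge0 ltW//.
  exact: plus_prob_gt0.
exact: plus_prob_lt1.
Qed.

Lemma fresh_mean_plus U s v (H : 'I_n -> config n -> R) :
  v \notin U -> (forall w t, 0 <= H w t) ->
  plus_floor * H v (set_spin s v true) <=
    (\sum_(w | w \notin U) update_mean beta w (H w) s) / #|~: U|%:R.
Proof.
move=> vU H0.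
have um0 w : 0 <= update_mean beta w (H w) s by exact: update_mean_ge0.
have U0 : (0 < #|~: U|)%N by apply/card_gt0P; exists v; rewrite inE.
have Un : (#|~: U| <= n)%N.
  exact: leq_trans (max_card _) (eq_leq (card_ord n)).
have f0 := ltW plus_floor_gt0.
rewrite /plus_floor [_ / n%:R * _]mulrAC.
apply: ler_pM.
- by rewrite mulr_ge0// divr_ge0// ltW// flip_floor_gt0.
- by rewrite invr_ge0.
- rewrite (bigD1 v)//= -[leLHS]addr0 lerD ?sumr_ge0//.
  rewrite /update_mean -[leLHS]addr0 lerD//.
    by rewrite ler_wpM2r// flip_floor_plus_prob.
  by rewrite mulr_ge0// subr_ge0 ltW// plus_prob_lt1.
- by rewrite lef_pV2 ?posrE ?ltr0n// ler_nat.
Qed.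

Lemma fresh_scan_mean_ge0 j U (g : config n -> R) s : (forall u, 0 <= g u) ->
  0 <= fresh_scan_mean beta j U g s.
Proof.
move=> g0; elim: j U s => [//|j IH] U s /=.
by rewrite divr_ge0// sumr_ge0// => v _; exact: update_mean_ge0.
Qed.

(** Each update sets a fresh vertex of our choice to plus with probability at
    least [plus_floor]. *)
Lemma fresh_scan_grow j U s v : v \notin U -> (j.+1 + #|U| <= n)%N ->
  exists t, [/\ below s t, t v &
    forall g : config n -> R, (forall u, 0 <= g u) ->
      plus_floor ^+ j.+1 * g t <= fresh_scan_mean beta j.+1 U g s].
Proof.
have s1 s' w : below s' (set_spin s' w true).
  by move=> u; rewrite ffunE; case: eqP.
elim: j U s v => [|j IH] U s v vU jU.
  exists (set_spin s v true); split => //; first by rewrite ffunE eqxx.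
  by move=> g g0; rewrite expr1; exact: (fresh_mean_plus s vU (fun _ => g0)).
have jU' : (j.+1 + #|v |: U| <= n)%N by rewrite cardsU1 vU add1n addnS -addSn.
have [v' v'U] : exists v', v' \notin v |: U.
  have : (0 < #|~: (v |: U)|)%N.
    by have := cardsC (v |: U); rewrite card_ord; move: jU'; clear; lia.
  by case/card_gt0P => v'; rewrite inE => h; exists v'.
have [t [st _ Ht]] := IH (v |: U) (set_spin s v true) v' v'U jU'.
exists t; split.
- by move=> u su; apply: st; apply: s1.
- by apply: st; rewrite ffunE eqxx.
move=> g g0; rewrite exprS -mulrA.
apply: le_trans (_ : _ <= plus_floor * fresh_scan_mean beta j.+1 (v |: U) g (set_spin s v true)) _.
  by rewrite (ler_wpM2l (ltW plus_floor_gt0))// Ht.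
apply: (fresh_mean_plus s vU (H := fun w => fresh_scan_mean beta j.+1 (w |: U) g)).
by move=> w t'; exact: fresh_scan_mean_ge0.
Qed.

Definition minus_count s : nat := #|[pred v | ~~ s v]|.
Local Notation alpha := (plus_floor ^+ k).

Lemma below_magnetization s t : below s t -> magnetization R s <= magnetization R t.
Proof.
move=> st; rewrite ler_wpM2r ?invr_ge0// ler_sum// => v _.
by have := st v; rewrite /spin; case: (s v); case: (t v) => h;
  [lra|have := h isT|lra|lra].
Qed.

(** A scan that only sets spins to plus keeps the magnetization nonnegative, so
    it is not folded; and it can start at a minus spin. *)
Lemma restricted_grow (x : omega_plus R n) : exists y : omega_plus R n,
  (minus_count (val y) <= (minus_count (val x)).-1)%N /\
  forall f : omega_plus R n -> R, (forall u, 0 <= f u) ->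
    alpha * f y <= expect P f x.
Proof.
have [v hv] : exists v, (minus_count (val x) == 0)%N || ~~ val x v.
  have [h|h] := posnP (minus_count (val x)).
    by exists (Ordinal n_gt0).
  by case/card_gt0P: h => v; rewrite inE => h; exists v; rewrite h orbT.
have k1 : (k.-1.+1 = k)%N by rewrite prednK.
have v0 : v \notin (finset.set0 : {set 'I_n}) by rewrite inE.
have kb : (k.-1.+1 + #|(finset.set0 : {set 'I_n})| <= n)%N by rewrite k1 cards0 addn0.
have [t [st tv Ht]] := fresh_scan_grow (val x) v0 kb.
rewrite k1 in Ht.
have t0 : 0 <= magnetization R t by apply: le_trans (below_magnetization st); exact: valP x.
exists (Sub t t0); split.
  rewrite SubK; case/orP: hv => [/eqP h|h].
    rewrite h leqn0; apply/eqP/eq_card0 => w; rewrite !inE.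
    apply/negbTE; rewrite negbK; apply: st; apply: contraT => xw.
    by have := card0_eq h w; rewrite !inE xw.
  rewrite /minus_count [X in (_ <= X.-1)%N](cardD1 v) inE h add1n/=.
  apply: subset_leq_card; apply/fintype.subsetP => w; rewrite !inE => tw.
  apply/andP; split; first by apply: contraNneq tw => ->.
  by apply: contraNN tw => /st.
move=> f f0; rewrite (expect_restricted_fold _ kn).
have -> : f (Sub t t0) = (f \o @fold_omega R n) t.
  by congr (f _); apply: val_inj; rewrite /= /fold_plus t0.
by apply: Ht => u; exact: f0.
Qed.

Lemma minus_count_eq0 s : minus_count s = 0 -> s = all_plus n.
Proof.
move=> h; apply/ffunP => v; rewrite ffunE.
by have := card0_eq h v; rewrite !inE => /negbFE.
Qed.

Lemma all_plus_in_omega_plus : 0 <= magnetization R (all_plus n).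
Proof.
rewrite magnetizationE divr_ge0// /signed_sum sumr_ge0// => v _.
by rewrite spin_sqr.
Qed.

Definition top : omega_plus R n := Sub (all_plus n) all_plus_in_omega_plus.

Lemma reach_top j (x : omega_plus R n) (f : omega_plus R n -> R) :
  (minus_count (val x) <= j)%N -> (forall u, 0 <= f u) ->
  alpha ^+ j * f top <= expect (step_pow P j) f x.
Proof.
move=> + f0; elim: j x => [|j IH] x xj.
  rewrite expr0 mul1r expect_step_id (_ : x = top)//.
  by apply: val_inj; rewrite SubK; apply: minus_count_eq0; apply/eqP; rewrite -leqn0.
have [y [yx Hy]] := restricted_grow x.
rewrite expect_step_powS exprS -mulrA.
have a0 : 0 <= alpha by rewrite exprn_ge0// ltW// plus_floor_gt0.
apply: le_trans (Hy _ _); last first.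
  move=> u; apply: sumr_ge0 => w _; rewrite mulr_ge0//.
  by apply: step_pow_ge0; exact: restricted_ge0.
apply: ler_wpM2l => //; apply: IH; apply: leq_trans yx _.
by rewrite -[j]/(j.+1.-1) -!subn1 leq_sub2r.
Qed.

Lemma step_pow_add a b (f : omega_plus R n -> R) x :
  expect (step_pow P (a + b)) f x = expect (step_pow P a) (expect (step_pow P b) f) x.
Proof.
elim: a x => [|a IH] x; first by rewrite add0n expect_step_id.
rewrite addSn !expect_step_powS; congr (expect _ _ _).
by apply/funext => y; exact: IH.
Qed.

Lemma minus_count_le s : (minus_count s <= n)%N.
Proof. exact: leq_trans (max_card _) (eq_leq (card_ord n)). Qed.

Lemma reach_top_prob_le1 : alpha ^+ n <= 1.
Proof.
have := reach_top (f := fun=> 1) (minus_count_le (val top)) (fun=> ler01).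
rewrite mulr1 /expect; under eq_bigr do rewrite mulr1.
by rewrite step_pow_sum1//; exact: restricted_sum1.
Qed.

(** From every state the chain is at [top] at time [n] with probability at least
    [alpha ^+ n], which is Doeblin's condition. *)
Lemma common_state_contraction (f : omega_plus R n -> R) (B : R) :
  (forall x y, f x - f y <= B) ->
  forall x y, expect (step_pow P n) f x - expect (step_pow P n) f y <=
    (1 - alpha ^+ n) * B.
Proof.
move=> fB x y.
set e := alpha ^+ n.
have aff := expect_affine (step_pow_sum1 (restricted_sum1 beta kn) n).
have e0 : 0 <= e by rewrite !exprn_ge0// ltW// plus_floor_gt0.
have e1 : e <= 1 := reach_top_prob_le1.
have [hi _ hiP] := @arg_maxP _ _ _ top xpredT f isT.
have [lo _ loP] := @arg_minP _ _ _ top xpredT f isT.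
have A1 : e * (f hi - f top) <= f hi - expect (step_pow P n) f x.
  have H := @reach_top n x (fun u => - 1 * f u + f hi) (minus_count_le (val x)).
  have /H : forall u, 0 <= - 1 * f u + f hi.
    by move=> u; have := hiP u isT; rewrite /= => h; lra.
  rewrite aff; rewrite -/e; lra.
have A2 : e * (f top - f lo) <= expect (step_pow P n) f y - f lo.
  have H := @reach_top n y (fun u => 1 * f u + - f lo) (minus_count_le (val y)).
  have /H : forall u, 0 <= 1 * f u + - f lo.
    by move=> u; have := loP u isT; rewrite /= => h; lra.
  rewrite aff; rewrite -/e; lra.
have : 0 <= (1 - e) * (B - (f hi - f lo)).
  by rewrite mulr_ge0// subr_ge0.
by lra.
Qed.

Lemma mixes_eventually : exists m, forall mu,
  stationary_distribution P mu -> worst_dist P mu m <= 1 / 4.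
Proof.
set e := alpha ^+ n.
have e0 : 0 < e by rewrite !exprn_gt0// plus_floor_gt0.
have pw j (f : omega_plus R n -> R) : (forall x y, f x - f y <= 1) ->
    forall x y, expect (step_pow P (n * j)) f x - expect (step_pow P (n * j)) f y
      <= (1 - e) ^+ j.
  move=> f1; elim: j => [|j IH] x y; first by rewrite muln0 !expect_step_id.
  by rewrite mulnS !step_pow_add exprS; exact: common_state_contraction.
pose j := Num.bound (3 / e).
exists (n * j)%N => mu st; apply: worst_dist_le st _ => // f x y f1.
apply: le_trans (pw j f _ x y) _.
  by move=> u w; apply: le_trans (f1 u w) _; case: (_ != _).
have je : 3 <= j%:R * e.
  by rewrite -ler_pdivrMr//; apply/ltW/archi_boundP; rewrite divr_ge0// ltW.
have e1 : e <= 1 := reach_top_prob_le1.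
apply: (@le_trans _ _ (expR (- e) ^+ j)).
  by rewrite lerXn2r ?nnegrE ?expR_ge0 ?subr_ge0//; exact: expR_ge1Dx.
rewrite -expRM_natl mulrN expRN.
have : 1 + j%:R * e <= expR (j%:R * e) by exact: expR_ge1Dx.
move=> h; rewrite div1r lef_pV2 ?posrE ?expR_gt0//; lra.
Qed.

End FixedSize.

(** * Bounds on the mixing time *)

Lemma omega_plus1_eq (R : realType) (x y : omega_plus R 1) : x = y.
Proof.
have plus (z : omega_plus R 1) : val z = all_plus 1.
  apply/ffunP => v; rewrite ffunE; have := valP z.
  rewrite /= /magnetization big_ord_recl big_ord0 addr0 divr1 (ord1 v) /spin.
  by case: (val z ord0) => //; lra.
by apply: val_inj; rewrite !plus.
Qed.

Lemma worst_dist0_le (R : realType) (beta : R) k mu :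
  stationary_distribution (@restricted_rss R beta 1 k) mu ->
  worst_dist (@restricted_rss R beta 1 k) mu 0 <= 1 / 4.
Proof.
move=> st; apply: worst_dist_le st _ => // f x y _.
by rewrite (omega_plus1_eq x y) subrr.
Qed.

(** One of two distinct states has stationary mass at most [1 / 2]. *)
Lemma worst_dist0_gt (R : realType) (beta : R) n k mu : (1 < n)%N -> (k <= n)%N ->
  stationary_distribution (@restricted_rss R beta n k) mu ->
  1 / 4 < worst_dist (@restricted_rss R beta n k) mu 0.
Proof.
move=> n1 kn st; have [mu0 mu1 _] := st.
have v0 : 'I_n by exact: Ordinal (ltnW n1).
pose a : omega_plus R n := top R n.
have b0 : 0 <= magnetization R (set_spin (all_plus n) v0 false).
  rewrite magnetizationE signed_sum_set_spin divr_ge0//.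
  have -> : signed_sum R (all_plus n) (all_plus n) = n%:R.
    rewrite /signed_sum (eq_bigr (fun=> 1)); first by rewrite sumr_const card_ord.
    by move=> v _; rewrite spin_sqr.
  rewrite !ffunE /spin; have : 2 <= n%:R :> R by rewrite ler_nat.
  lra.
pose b : omega_plus R n := Sub (set_spin (all_plus n) v0 false) b0.
have ab : a != b.
  apply/eqP => /(congr1 val)/ffunP/(_ v0).
  by rewrite !SubK !ffunE eqxx.
have key x : 1 - mu x <= worst_dist (@restricted_rss R beta n k) mu 0.
  have := @worst_dist_ge R _ _ (restricted_sum1 beta kn) mu 0 x
    (fun t => (t != x)%:R) st.
  rewrite expect_step_id eqxx subr0 => H; apply: le_trans (H _).
    rewrite -{1}mu1 (bigD1 x)//= addrAC subrr add0r.
    rewrite [leRHS](bigD1 x)//= eqxx mulr0 add0r.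
    rewrite le_eqVlt; apply/orP; left; apply/eqP/eq_bigr => t tx.
    by rewrite tx /= mulr1.
  by move=> t; rewrite ler0n lern1 leq_b1.
have : mu a + mu b <= 1.
  rewrite -mu1 (bigD1 a)//= lerD2l (bigD1 b) 1?eq_sym//= lerDl sumr_ge0//.
have := key a; have := key b; lra.
Qed.

Section MixingTime.
Variables (R : realType) (T : finType) (P : T -> T -> R) (mu : T -> R).

Lemma mixing_time_le m (B : R) : worst_dist P mu m <= 1 / 4 -> m%:R <= B ->
  (mixing_time P mu (1 / 4) <= B%:E)%E.
Proof.
move=> h mB; apply: (@le_trans _ _ (m%:R%:E)%E); last by rewrite lee_fin.
by apply: ereal_inf_lbound; exists m.
Qed.

Lemma mixing_time_ge (B : R) :
  (forall m, m%:R < B -> 1 / 4 < worst_dist P mu m) ->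
  (B%:E <= mixing_time P mu (1 / 4))%E.
Proof.
move=> h; apply: le_ereal_inf_tmp => _ [m /= hm <-]; rewrite lee_fin leNgt.
by apply/negP => /h; rewrite ltNge hm.
Qed.
End MixingTime.

Section Assembly.
Variables (R : realType) (beta : R) (k : nat -> nat).
Hypotheses (beta_gt1 : 1 < beta)
  (hk : forall n : nat, (0 < n)%N -> (1 <= k n <= n)%N).
Let beta_gt0 : 0 < beta. Proof. by have := beta_gt1; lra. Qed.
Local Notation P n := (@restricted_rss R beta n (k n)).
Local Notation scale n := (n%:R * ln n%:R / (k n)%:R : R).

Lemma scale_gt0 n : (1 < n)%N -> 0 < scale n.
Proof.
move=> n1; have /andP[k1 _] := hk (ltnW n1).
by rewrite divr_gt0 ?mulr_gt0 ?ltr0n ?(ltnW n1)// ln_gt0// ltr1n.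
Qed.

Lemma scale1 : scale 1 = 0.
Proof. by rewrite ln1 mulr0 mul0r. Qed.

(** A maximum over finitely many sizes; for one vertex the chain has a single
    state and both sides vanish. *)
Lemma upper_bound_small N0 : exists2 C : R, 0 < C &
  forall n mu, (0 < n < N0)%N -> stationary_distribution (P n) mu ->
    (mixing_time (P n) mu (1 / 4) <= (C * scale n)%:E)%E.
Proof.
elim: N0 => [|N0 [C C0 IH]]; first by exists 1 => // n mu; rewrite ltn0 andbF.
have [N01|N01] := leqP N0 1.
  exists 1 => // n mu /andP[n0 nN]; have nE : n = 1%N by lia.
  move: mu; rewrite nE => mu st; apply: (@mixing_time_le _ _ _ _ 0); first exact: worst_dist0_le.
  by rewrite scale1 mulr0.
have /andP[k1 kn] := hk (ltnW N01).
have [m Hm] := mixes_eventually beta_gt0 k1 kn.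
have s0 := scale_gt0 N01.
exists (Num.max C (m%:R / scale N0)); first by rewrite lt_max C0.
move=> n mu /andP[n0]; rewrite ltnS leq_eqVlt => /predU1P[nE|nN] st.
  move: mu st; rewrite nE => mu st; apply: mixing_time_le (Hm _ st) _.
  by rewrite -ler_pdivrMr// le_max lexx orbT.
apply: le_trans (IH n mu _ st) _; first by rewrite n0.
rewrite lee_fin ler_wpM2r ?le_max ?lexx//.
case: (n =P 1%N) => [->|n1]; first by rewrite scale1.
by apply/ltW/scale_gt0; lia.
Qed.

(** For at least two vertices the chain is not mixed at time 0. *)
Lemma lower_bound_small N0 : exists2 c : R, 0 < c &
  forall n mu, (0 < n < N0)%N -> stationary_distribution (P n) mu ->
    ((c * scale n)%:E <= mixing_time (P n) mu (1 / 4))%E.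
Proof.
elim: N0 => [|N0 [c c0 IH]]; first by exists 1 => // n mu; rewrite ltn0 andbF.
have [N01|N01] := leqP N0 1.
  exists 1 => // n mu /andP[n0 nN]; have nE : n = 1%N by lia.
  move: mu; rewrite nE => mu st; apply: mixing_time_ge => m; rewrite scale1 mulr0.
  by rewrite ltNge ler0n.
have /andP[k1 kn] := hk (ltnW N01).
have s0 := scale_gt0 N01.
exists (Num.min c (scale N0)^-1); first by rewrite lt_min c0 invr_gt0.
move=> n mu /andP[n0]; rewrite ltnS leq_eqVlt => /predU1P[nE|nN] st.
  move: mu st; rewrite nE => mu st; apply: mixing_time_ge => m.
  have : Num.min c (scale N0)^-1 * scale N0 <= 1.
    by rewrite -ler_pdivlMr// div1r ge_min lexx orbT.
  move=> /[swap] /lt_le_trans /[apply].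
  rewrite ltrn1 ltnS leqn0 => /eqP ->; exact: worst_dist0_gt.
apply: le_trans (IH n mu _ st); last by rewrite n0.
rewrite lee_fin ler_wpM2r ?ge_min ?lexx//.
case: (n =P 1%N) => [->|n1]; first by rewrite scale1.
by apply/ltW/scale_gt0; lia.
Qed.

Local Open Scope classical_set_scope.
Hypothesis hko : (fun n : nat => (k n)%:R : R^o) =o_\oo
                 (fun n : nat => Num.sqrt (n%:R : R) : R^o).

Lemma k_sqr_small (e : R) : 0 < e ->
  exists N0, forall n, (N0 <= n)%N -> (k n)%:R ^+ 2 <= e * n%:R.
Proof.
move=> e0; have s0 : 0 < Num.sqrt e by rewrite sqrtr_gt0.
have [N0 _ H] := (eqoP _ _ _).1 hko _ s0.
exists N0 => n /H /=; rewrite normr_nat ger0_norm ?sqrtr_ge0// => h.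
rewrite -(sqr_sqrtr (ltW e0)) -[n%:R in leRHS](@sqr_sqrtr _ n%:R)// -exprMn.
by apply: lerXn2r h; rewrite nnegrE//; exact: mulr_ge0 (sqrtr_ge0 _) (sqrtr_ge0 _).
Qed.

Lemma upper_bound_large : exists C : R, exists N0 : nat, 0 < C /\
  forall n mu, (N0 <= n)%N -> (0 < n)%N -> stationary_distribution (P n) mu ->
    (mixing_time (P n) mu (1 / 4) <= (C * scale n)%:E)%E.
Proof.
have [C [e [N1 [C0 e0 H]]]] := worst_dist_after_nlogn beta_gt1.
have [N2 kN2] := k_sqr_small e0.
exists (C + 1), (maxn (maxn N1 N2) (Num.bound (expR 1 : R))).
split; first by rewrite addr_gt0.
move=> n mu; rewrite !geq_max => /andP[/andP[n1 n2] n3] n0 st.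
have /andP[k1 kn] := hk n0.
have kR : 0 < (k n)%:R :> R by rewrite ltr0n.
have nR : 0 < n%:R :> R by rewrite ltr0n.
have ln1 : 1 <= ln n%:R :> R.
  rewrite -[leLHS]expRK ler_ln ?posrE ?expR_gt0//.
  apply: le_trans (ltW (archi_boundP (ltW (expR_gt0 1)))) _.
  by rewrite ler_nat.
have S1 : 1 <= scale n.
  rewrite ler_pdivlMr// mul1r; apply: (@le_trans _ _ n%:R); first by rewrite ler_nat.
  by rewrite ler_peMr// ltW.
have CS0 : 0 <= C * scale n by rewrite mulr_ge0// ltW// (lt_le_trans ltr01).
pose m' := Num.truncn (C * scale n).
have /andP[m1 m2] := truncn_itv CS0.
apply: (@mixing_time_le _ _ _ _ m'.+1); last first.
  by rewrite -natr1 mulrDl mul1r lerD.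
apply: H => //; first exact: kN2.
apply: (@le_trans _ _ (C * scale n * (k n)%:R)).
  by rewrite -mulrA divfK// lt0r_neq0.
by rewrite ler_pM2r// ltW.
Qed.

Lemma lower_bound_large : exists c : R, exists N0 : nat, 0 < c /\
  forall n mu, (N0 <= n)%N -> (0 < n)%N -> stationary_distribution (P n) mu ->
    ((c * scale n)%:E <= mixing_time (P n) mu (1 / 4))%E.
Proof.
have [c [N1 [c0 H]]] := worst_dist_before_nlogn beta_gt0.
have [N2 kN2] := k_sqr_small (@ltr01 R).
exists c, (maxn N1 N2); split => //.
move=> n mu; rewrite geq_max => /andP[n1 n2] n0 st.
have /andP[k1 kn] := hk n0.
have kR : 0 < (k n)%:R :> R by rewrite ltr0n.
apply: mixing_time_ge => m mS; apply: H => //.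
  by have := kN2 n n2; rewrite mul1r -natrX ler_nat -mulnn.
rewrite -ler_pdivlMr//; apply: le_trans (ltW mS) _.
by rewrite mulrA.
Qed.

Lemma scale_ge0 n : (0 < n)%N -> 0 <= scale n.
Proof.
case: n => [//|[_|n _]]; first by rewrite scale1.
exact/ltW/scale_gt0.
Qed.

End Assembly.

Unset Implicit Arguments.
Local Open Scope classical_set_scope.
Local Open Scope ring_scope.

Theorem theorem1p3 (R : realType) (beta : R) (hbeta : 1 < beta)
  (k : nat -> nat) (hk : forall n : nat, (0 < n)%N -> (1 <= k n <= n)%N)
  (hko : (fun n : nat => (k n)%:R : R^o) =o_\oo
         (fun n : nat => Num.sqrt (n%:R : R) : R^o)) :
  exists c1 c2 : R, [/\ 0 < c1, 0 < c2 &
    forall (n : nat) (mu_plus : omega_plus R n -> R),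
      (0 < n)%N ->
      stationary_distribution (@restricted_rss R beta n (k n)) mu_plus ->
      ((c1 * (n%:R * ln n%:R / (k n)%:R))%:E
         <= mixing_time (@restricted_rss R beta n (k n)) mu_plus (1 / 4))%E /\
      (mixing_time (@restricted_rss R beta n (k n)) mu_plus (1 / 4)
         <= (c2 * (n%:R * ln n%:R / (k n)%:R))%:E)%E].
Proof.
have [cl [Nl [cl0 Hl]]] := lower_bound_large hbeta hk hko.
have [Cu [Nu [Cu0 Hu]]] := upper_bound_large hbeta hk hko.
have [cs cs0 Hs] := lower_bound_small hbeta hk Nl.
have [Cs Cs0 Hs'] := upper_bound_small hbeta hk Nu.
exists (Num.min cl cs), (Num.max Cu Cs).
split; [by rewrite lt_min cl0|by rewrite lt_max Cu0|].
move=> n mu n0 st; have S0 := scale_ge0 R hk n0; split.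
- have [nl|nl] := leqP Nl n.
    apply: le_trans (Hl n mu nl n0 st); rewrite lee_fin ler_wpM2r//.
    by rewrite ge_min lexx.
  apply: le_trans (Hs n mu _ st); last by rewrite n0.
  by rewrite lee_fin ler_wpM2r// ge_min lexx orbT.
- have [nu|nu] := leqP Nu n.
    apply: le_trans (Hu n mu nu n0 st) _; rewrite lee_fin ler_wpM2r//.
    by rewrite le_max lexx.
  apply: le_trans (Hs' n mu _ st) _; first by rewrite n0.
  by rewrite lee_fin ler_wpM2r// le_max lexx orbT.
Qed.
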